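(* (Soundness and completeness of $F\!N\!\mathit{4}$.) Let $\mathcal{L}$ be a first-order language and $\Gamma\cup\{A\}\subseteq Sent(\mathcal{L})$ (sentences now possibly containing $\rightarrow$). Then $\Gamma\vdash A$ in the natural deduction system $F\!N\!\mathit{4}$ if and only if for every $F\!N\!\mathit{4}$-model $\mathcal{K}$ for $\mathcal{L}$ and every stage $w$ of $\mathcal{K}$, if $\mathcal{K},w\vDash B$ for all $B\in\Gamma$ then $\mathcal{K},w\vDash A$.
   Context: Language: connectives $\neg,\land,\lor,\rightarrow$, quantifiers $\forall,\exists$, variables, identity $\doteq$, unary definedness predicate $\mathbf{D}$. A first-order language is $\mathcal{L}=\langle\mathcal{C},\mathcal{P}\rangle$, $\mathcal{C}$ an infinite set of constants, $\mathcal{P}$ a (possibly empty) set of predicate letters of finite arities; $\mathcal{P}^{\doteq}=\mathcal{P}\cup\{\doteq\}$; atomic formulas are $Pt_1\dots t_m$, $t_1\doteq t_2$, $\mathbf{D}t$; $c_1\neq c_2$ abbreviates $\neg(c_1\doteq c_2)$; $A(c/x)$ is substitution of $c$ for free $x$. Proof system $F\!N\!\mathit{4}$: deductions are natural-deduction trees of sentences of $\mathcal{L}$; $\Gamma\vdash A$ means a deduction of $A$ with undischarged hypotheses in $\Gamma$. Rules: $\land$I ($A,B/A\land B$); $\land$E ($A\land B/A$, $A\land B/B$); $\lor$I ($A/A\lor B$, $B/A\lor B$); $\lor$E (from $A\lor B$ and derivations of $C$ from $A$ and from $B$, infer $C$, discharging); $\neg\land$I ($\neg A/\neg(A\land B)$,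 $\neg B/\neg(A\land B)$); $\neg\land$E (from $\neg(A\land B)$ and derivations of $C$ from $\neg A$ and from $\neg B$, infer $C$); $\neg\lor$I ($\neg A,\neg B/\neg(A\lor B)$); $\neg\lor$E ($\neg(A\lor B)/\neg A$, $/\neg B$); DN ($A/\neg\neg A$, $\neg\neg A/A$); $\mathbf{D}$I (for $m$-ary $P\in\mathcal{P}^{\doteq}$, $1\le i\le m$: $Pc_1..c_m/\mathbf{D}c_i$ and $\neg Pc_1..c_m/\mathbf{D}c_i$); PEX$_\mathbf{D}$ ($\mathbf{D}c,\neg\mathbf{D}c/B$); PEM$_\mathbf{D}$ (infer $\mathbf{D}c\lor\neg\mathbf{D}c$ outright); $\forall$I$_\mathbf{D}$ (from a derivation of $A(c/x)$ from $\mathbf{D}c$ infer $\forall xA$, discharging $\mathbf{D}c$); $\forall$E$_\mathbf{D}$ ($\forall xA,\mathbf{D}c/A(c/x)$); $\exists$I$_\mathbf{D}$ ($A(c/x),\mathbf{D}c/\exists xA$); $\exists$E$_\mathbf{D}$ (from $\exists xA$ and a derivation of $B$ from $A(c/x),\mathbf{D}c$ infer $B$, discharging); $\neg\forall$I$_\mathbf{D}$ ($\neg A(c/x),\mathbf{D}c/\neg\forall xA$); $\neg\forall$E$_\mathbf{D}$ (from $\neg\forall xA$ and a derivation of $B$ from $\neg A(c/x),\mathbf{D}c$ infer $B$, discharging); $\neg\exists$I$_\mathbf{D}$ (from a derivation of $\neg A(c/x)$ from $\mathbf{D}c$ infer $\neg\exists xA$, discharging); $\neg\exists$E$_\mathbf{D}$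 ($\neg\exists xA,\mathbf{D}c/\neg A(c/x)$); $\doteq$I ($\mathbf{D}c/c\doteq c$); $\doteq$E ($A(c_1/x),c_1\doteq c_2/A(c_2/x)$, $A$ atomic or negated atomic); $\neq$I ($A(c_1/x),\neg A(c_2/x)/c_1\neq c_2$, $A$ atomic with $x$ free); $\rightarrow$I (from a derivation of $B$ from hypothesis $A$ infer $A\rightarrow B$, discharging $A$); $\rightarrow$E ($A\rightarrow B,A/B$); $\neg\!\rightarrow$I ($A,\neg B/\neg(A\rightarrow B)$); $\neg\!\rightarrow$E ($\neg(A\rightarrow B)/A$ and $\neg(A\rightarrow B)/\neg B$). Eigenvariable restrictions: in $\forall$I$_\mathbf{D}$, $\neg\exists$I$_\mathbf{D}$, $c$ does not occur in $A$ nor in any undischarged hypothesis other than $\mathbf{D}c$; in $\exists$E$_\mathbf{D}$, $\neg\forall$E$_\mathbf{D}$, $c$ does not occur in $A$, $B$, nor in hypotheses of the minor derivation other than the discharged ones. Semantics: an $F\!N\!\mathit{4}$-model for $\mathcal{L}$ is a structure $\langle W,\le,d,I,i_+,i_-\rangle$: $W\neq\emptyset$; $\le$ a preorder; $d(w)$ a possibly empty set, $d(w)\subseteq d(w')$ for $w\le w'$; $I$ partial on $(\mathcal{C}\cup\mathcal{P})\times W$ with $I(c,w)\in d(w)$ when defined and then $I(c,w')=I(c,w)$ for $w'\ge w$; $I(P,w)=\langle P^w_+,P^w_-\rangle$, $P^w_\pm\subseteq d(w)^m$, monotone in $w$; $i_\pm(w)$ binary relations on $d(w)$ with (a) $i_+(w)$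 an equivalence relation and a congruence for each $P^w_+$ and $P^w_-$ ($P\in\mathcal{P}$); (b) with $\doteq^w_\pm=i_\pm(w)$: if for some $P\in\mathcal{P}^{\doteq}$ a tuple containing $a$ lies in $P^w_+$ and the same tuple with $a'$ in place of $a$ (same positions) lies in $P^w_-$, then $\langle a,a'\rangle,\langle a',a\rangle\in i_-(w)$; (c) $i_\pm$ monotone in $w$. Diagram language $\mathcal{L}_\mathcal{K}$ adds constants $\bar a$ for $a\in\bigcup_w d(w)$; $\hat I(\bar a,w)=a$ if $a\in d(w)$, undefined otherwise, else $\hat I=I$. Induced valuation $v$ on $Sent(\mathcal{L}_\mathcal{K})\times W$: $v(\mathbf{D}c,w)=1$ iff $\hat I(c,w)$ defined; $v(\neg\mathbf{D}c,w)=1$ iff undefined; $v(c_1\doteq c_2,w)=1$ (resp. $v(c_1\neq c_2,w)=1$) iff $\hat I(c_1,w),\hat I(c_2,w)$ defined and their pair is in $i_+(w)$ (resp. $i_-(w)$); for $P\in\mathcal{P}$, $v(Pc_1..c_m,w)=1$ (resp. $v(\neg Pc_1..c_m,w)=1$) iff all $\hat I(c_i,w)$ defined and the tuple is in $P^w_+$ (resp. $P^w_-$); $\land,\lor$ classical; $v(\neg(A\land B))=1$ iff $v(\neg A)=1$ or $v(\neg B)=1$; $v(\neg(A\lor B))=1$ iff both $v(\neg A)=v(\neg B)=1$; $v(\neg\neg A)=v(A)$; $v(\forall xA,w)=1$ iff $v(A(\bar a/x),w')=1$ for all $w'\ge w$, $a\in d(w')$; $v(\exists xA,w)=1$ iff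 $v(A(\bar a/x),w)=1$ for some $a\in d(w)$; $v(\neg\forall xA,w)=1$ iff $v(\neg A(\bar a/x),w)=1$ for some $a\in d(w)$; $v(\neg\exists xA,w)=1$ iff $v(\neg A(\bar a/x),w')=1$ for all $w'\ge w$, $a\in d(w')$; $v(A\rightarrow B,w)=1$ iff for every $w'\ge w$, $v(A,w')=1$ implies $v(B,w')=1$; $v(\neg(A\rightarrow B),w)=1$ iff $v(A,w)=1$ and $v(\neg B,w)=1$. $\mathcal{K},w\vDash A$ iff $v(A,w)=1$.
   Formalization: Two repairs, as soundness fails literally: in models, for w ≤ w', I(c,w') = I(c,w) also for undefinedness (an undefined constant stays undefined); and in the rule ≠I, A must be Pt1…tm with P a predicate letter or identity, so A = Dx is excluded. *)

(* Defs.v *)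
From mathcomp Require Import all_boot.
From mathcomp Require Import boolp classical_sets functions cardinality.

Set Implicit Arguments.
Unset Strict Implicit.
Unset Printing Implicit Defensive.

Local Open Scope classical_set_scope.

Record language := Language {
  const : Type;
  pred : Type;
  arity : pred -> nat;
  const_infinite : infinite_set [set: const] }.

(* P u {=}: [None] is the identity sign. *)
Definition predE (L : language) : Type := option (pred L).

Definition arityE (L : language) (P : predE L) : nat :=
  if P is Some Q then arity Q else 2.

Inductive term (L : language) :=
| Var of nat
| Cst of const L.
Arguments Var {L} _.
Arguments Cst {L} _.

Inductive formula (L : language) :=
| Atom (P : predE L) (ts : (arityE P).-tuple (term L))
| Def (t : term L)
| Not (A : formula L)
| And (A B : formula L)
| Or (A B : formula L)
| Imp (A B : formula L)
| All (x : nat) (A : formula L)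
| Ex (x : nat) (A : formula L).

Definition Eqn (L : language) (t u : term L) : formula L :=
  Atom (P := None) [tuple t; u].

Definition is_var (L : language) (x : nat) (t : term L) : bool :=
  if t is Var y then y == x else false.

Fixpoint free (L : language) (x : nat) (A : formula L) : bool :=
  match A with
  | Atom P ts => has (is_var x) ts
  | Def t => is_var x t
  | Not B => free x B
  | And B C | Or B C | Imp B C => free x B || free x C
  | All y B | Ex y B => (y != x) && free x B
  end.

Definition sentence (L : language) (A : formula L) : Prop :=
  forall x, ~~ free x A.

Fixpoint occurs (L : language) (c : const L) (A : formula L) : Prop :=
  match A with
  | Atom P ts => exists i, tnth ts i = Cst c
  | Def t => t = Cst c
  | Not B => occurs c B
  | And B C | Or B C | Imp B C => occurs c B \/ occurs c C
  | All _ B | Ex _ B => occurs c B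
  end.

Definition subst_term (L : language) (c : const L) (x : nat) (t : term L) :=
  if is_var x t then Cst c else t.

(* A(c/x); a constant cannot be captured. *)
Fixpoint subst (L : language) (c : const L) (x : nat) (A : formula L) :
    formula L :=
  match A with
  | Atom P ts => Atom (map_tuple (subst_term c x) ts)
  | Def t => Def (subst_term c x t)
  | Not B => Not (subst c x B)
  | And B C => And (subst c x B) (subst c x C)
  | Or B C => Or (subst c x B) (subst c x C)
  | Imp B C => Imp (subst c x B) (subst c x C)
  | All y B => All y (if y == x then B else subst c x B)
  | Ex y B => Ex y (if y == x then B else subst c x B)
  end.

(* Pt1..tm with P in P u {=} *)
Definition pred_atom (L : language) (A : formula L) : Prop :=
  exists P ts, A = @Atom L P ts.

Definition atomic (L : language) (A : formula L) : Prop :=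
  pred_atom A \/ exists t, A = Def t.

Definition fresh_for (L : language) (c : const L) (H : set (formula L)) : Prop :=
  forall B, H B -> ~ occurs c B.

(* [deduction H A]: there is a natural deduction tree with conclusion A whose
   set of undischarged hypotheses is H.  A rule that discharges hypotheses
   removes them from the set of the corresponding subtree.  The [sentence]
   premises are those needed for every formula of a tree to be a sentence (see
   [deduction_sentence]). *)
Inductive deduction (L : language) : set (formula L) -> formula L -> Prop :=
| d_hyp A : sentence A -> deduction [set A] A
| d_andI H1 H2 A B : deduction H1 A -> deduction H2 B ->
    deduction (H1 `|` H2) (And A B)
| d_andE1 H A B : deduction H (And A B) -> deduction H A
| d_andE2 H A B : deduction H (And A B) -> deduction H B
| d_orI1 H A B : sentence B -> deduction H A -> deduction H (Or A B)
| d_orI2 H A B : sentence A -> deduction H B -> deduction H (Or A B)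
| d_orE H H1 H2 A B C : deduction H (Or A B) ->
    deduction H1 C -> deduction H2 C ->
    deduction (H `|` (H1 `\` [set A]) `|` (H2 `\` [set B])) C
| d_nandI1 H A B : sentence B -> deduction H (Not A) ->
    deduction H (Not (And A B))
| d_nandI2 H A B : sentence A -> deduction H (Not B) ->
    deduction H (Not (And A B))
| d_nandE H H1 H2 A B C : deduction H (Not (And A B)) ->
    deduction H1 C -> deduction H2 C ->
    deduction (H `|` (H1 `\` [set Not A]) `|` (H2 `\` [set Not B])) C
| d_norI H1 H2 A B : deduction H1 (Not A) -> deduction H2 (Not B) ->
    deduction (H1 `|` H2) (Not (Or A B))
| d_norE1 H A B : deduction H (Not (Or A B)) -> deduction H (Not A)
| d_norE2 H A B : deduction H (Not (Or A B)) -> deduction H (Not B)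
| d_dnI H A : deduction H A -> deduction H (Not (Not A))
| d_dnE H A : deduction H (Not (Not A)) -> deduction H A
| d_defI H (P : predE L) (cs : (arityE P).-tuple (const L)) i :
    deduction H (Atom (map_tuple Cst cs)) ->
    deduction H (Def (Cst (tnth cs i)))
| d_defNI H (P : predE L) (cs : (arityE P).-tuple (const L)) i :
    deduction H (Not (Atom (map_tuple Cst cs))) ->
    deduction H (Def (Cst (tnth cs i)))
| d_pexD H1 H2 c B : sentence B ->
    deduction H1 (Def (Cst c)) -> deduction H2 (Not (Def (Cst c))) ->
    deduction (H1 `|` H2) B
| d_pemD c : deduction set0 (Or (Def (Cst c)) (Not (Def (Cst c))))
| d_allI H c x A : deduction H (subst c x A) ->
    ~ occurs c A -> fresh_for c (H `\` [set Def (Cst c)]) ->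
    deduction (H `\` [set Def (Cst c)]) (All x A)
| d_allE H1 H2 c x A : deduction H1 (All x A) -> deduction H2 (Def (Cst c)) ->
    deduction (H1 `|` H2) (subst c x A)
| d_exI H1 H2 c x A :
    deduction H1 (subst c x A) -> deduction H2 (Def (Cst c)) ->
    deduction (H1 `|` H2) (Ex x A)
| d_exE H1 H2 c x A B : deduction H1 (Ex x A) -> deduction H2 B ->
    ~ occurs c A -> ~ occurs c B ->
    fresh_for c (H2 `\` [set subst c x A] `\` [set Def (Cst c)]) ->
    deduction (H1 `|` (H2 `\` [set subst c x A] `\` [set Def (Cst c)])) B
| d_nallI H1 H2 c x A :
    deduction H1 (Not (subst c x A)) -> deduction H2 (Def (Cst c)) ->
    deduction (H1 `|` H2) (Not (All x A))
| d_nallE H1 H2 c x A B : deduction H1 (Not (All x A)) -> deduction H2 B ->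
    ~ occurs c A -> ~ occurs c B ->
    fresh_for c (H2 `\` [set Not (subst c x A)] `\` [set Def (Cst c)]) ->
    deduction (H1 `|` (H2 `\` [set Not (subst c x A)] `\` [set Def (Cst c)])) B
| d_nexI H c x A : deduction H (Not (subst c x A)) ->
    ~ occurs c A -> fresh_for c (H `\` [set Def (Cst c)]) ->
    deduction (H `\` [set Def (Cst c)]) (Not (Ex x A))
| d_nexE H1 H2 c x A :
    deduction H1 (Not (Ex x A)) -> deduction H2 (Def (Cst c)) ->
    deduction (H1 `|` H2) (Not (subst c x A))
| d_eqI H c : deduction H (Def (Cst c)) -> deduction H (Eqn (Cst c) (Cst c))
| d_eqE H1 H2 c1 c2 x A : atomic A \/ (exists2 B, atomic B & A = Not B) ->
    deduction H1 (subst c1 x A) -> deduction H2 (Eqn (Cst c1) (Cst c2)) ->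
    deduction (H1 `|` H2) (subst c2 x A)
(* A is Pt1..tm with P in P u {=}.  With A := Dx the rule would derive
   c1 != c2 from Dc1 and ~Dc2, which no clause for identity validates. *)
| d_neqI H1 H2 c1 c2 x A : pred_atom A -> free x A ->
    deduction H1 (subst c1 x A) -> deduction H2 (Not (subst c2 x A)) ->
    deduction (H1 `|` H2) (Not (Eqn (Cst c1) (Cst c2)))
| d_impI H A B : sentence A -> deduction H B ->
    deduction (H `\` [set A]) (Imp A B)
| d_impE H1 H2 A B : deduction H1 (Imp A B) -> deduction H2 A ->
    deduction (H1 `|` H2) B
| d_nimpI H1 H2 A B : deduction H1 A -> deduction H2 (Not B) ->
    deduction (H1 `|` H2) (Not (Imp A B))
| d_nimpE1 H A B : deduction H (Not (Imp A B)) -> deduction H A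
| d_nimpE2 H A B : deduction H (Not (Imp A B)) -> deduction H (Not B).

Definition provable (L : language) (G : set (formula L)) (A : formula L) :=
  exists2 H : set (formula L), H `<=` G & deduction H A.

(* [elem] is an ambient type for the domains d(w); [icst] and [ppos]/[pneg]
   are the two parts of I, and [ieqp]/[ieqn] are i_+ and i_-. *)
Record structure (L : language) := Structure {
  world : Type;
  le : world -> world -> Prop;
  elem : Type;
  dom : world -> set elem;
  icst : const L -> world -> option elem;
  ppos : forall P : pred L, world -> set ((arity P).-tuple elem);
  pneg : forall P : pred L, world -> set ((arity P).-tuple elem);
  ieqp : world -> elem -> elem -> Prop;
  ieqn : world -> elem -> elem -> Prop }.
Arguments ppos {L s} P w.
Arguments pneg {L s} P w.

(* The extensions P_+^w, P_-^w for P in P u {=}. *)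
Definition pposE (L : language) (K : structure L) (P : predE L) (w : world K) :
    set ((arityE P).-tuple (elem K)) :=
  match P return set ((arityE P).-tuple (elem K)) with
  | Some Q => ppos Q w
  | None => fun s => ieqp w (tnth s ord0) (tnth s ord_max)
  end.

Definition pnegE (L : language) (K : structure L) (P : predE L) (w : world K) :
    set ((arityE P).-tuple (elem K)) :=
  match P return set ((arityE P).-tuple (elem K)) with
  | Some Q => pneg Q w
  | None => fun s => ieqn w (tnth s ord0) (tnth s ord_max)
  end.

Arguments pposE {L K} P w.
Arguments pnegE {L K} P w.

(* s contains a, and s' is s with a' in place of a at one or more positions *)
Definition replaced (T : Type) (m : nat) (a a' : T) (s s' : m.-tuple T) : Prop :=
  (exists i, tnth s i = a /\ tnth s' i = a') /\
  (forall i, tnth s' i = tnth s i \/ (tnth s i = a /\ tnth s' i = a')).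

Record is_model (L : language) (K : structure L) : Prop := IsModel {
  world_nonempty : exists w : world K, True;
  le_refl : forall w : world K, le w w;
  le_trans : forall u v w : world K, le u v -> le v w -> le u w;
  dom_mono : forall w w' : world K, le w w' -> dom w `<=` dom w';
  icst_dom : forall (c : const L) (w : world K) a,
    icst c w = Some a -> dom w a;
  (* I(c,w') = I(c,w) as an equation between partial values: neither side is
     defined without the other.  If c could become defined, ~Dc would not
     persist along <= and the introduction rules for -> and the universal
     quantifier would be unsound. *)
  icst_stable : forall (c : const L) (w w' : world K), le w w' ->
    icst c w' = icst c w;
  ppos_dom : forall (P : pred L) (w : world K) s, ppos P w s ->
    forall i, dom w (tnth s i);
  pneg_dom : forall (P : pred L) (w : world K) s, pneg P w s ->
    forall i, dom w (tnth s i);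
  ppos_mono : forall (P : pred L) (w w' : world K), le w w' ->
    ppos P w `<=` ppos P w';
  pneg_mono : forall (P : pred L) (w w' : world K), le w w' ->
    pneg P w `<=` pneg P w';
  ieqp_dom : forall (w : world K) a b, ieqp w a b -> dom w a /\ dom w b;
  ieqn_dom : forall (w : world K) a b, ieqn w a b -> dom w a /\ dom w b;
  ieqp_refl : forall (w : world K) a, dom w a -> ieqp w a a;
  ieqp_sym : forall (w : world K) a b, ieqp w a b -> ieqp w b a;
  ieqp_trans : forall (w : world K) a b c,
    ieqp w a b -> ieqp w b c -> ieqp w a c;
  ieqp_ppos : forall (P : pred L) (w : world K) s s',
    (forall i, ieqp w (tnth s i) (tnth s' i)) -> ppos P w s -> ppos P w s';
  ieqp_pneg : forall (P : pred L) (w : world K) s s',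
    (forall i, ieqp w (tnth s i) (tnth s' i)) -> pneg P w s -> pneg P w s';
  ieqn_intro : forall (P : predE L) (w : world K) s s' a a',
    pposE P w s -> pnegE P w s' -> replaced a a' s s' ->
    ieqn w a a' /\ ieqn w a' a;
  ieqp_mono : forall (w w' : world K) a b, le w w' -> ieqp w a b -> ieqp w' a b;
  ieqn_mono : forall (w w' : world K) a b, le w w' -> ieqn w a b -> ieqn w' a b }.

Record model (L : language) := Model {
  model_structure :> structure L;
  modelP : is_model model_structure }.

Definition diagram_const (L : language) (K : structure L) : Type :=
  (const L + {a : elem K | exists w, dom w a})%type.

Lemma diagram_const_infinite (L : language) (K : structure L) :
  infinite_set [set: diagram_const K].
Proof.
move=> fin; apply: (@const_infinite L).
have -> : [set: const L] = (inl : _ -> diagram_const K) @^-1` [set: _].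
  by rewrite preimage_setT.
by apply: finite_preimage => // x y _ _ [].
Qed.

(* L_K: the constant of a is [bar], for any w with a in d(w). *)
Definition diagram (L : language) (K : structure L) : language :=
  {| const := diagram_const K; pred := pred L; arity := @arity L;
     const_infinite := @diagram_const_infinite L K |}.

Definition bar (L : language) (K : structure L) (w : world K) (a : elem K)
    (ha : dom w a) : const (diagram K) :=
  inr (exist _ a (ex_intro _ w ha)).

Definition embed_term (L : language) (K : structure L) (t : term L) :
    term (diagram K) :=
  match t with Var x => Var x | Cst c => Cst (inl c : const (diagram K)) end.

Fixpoint embed (L : language) (K : structure L) (A : formula L) :
    formula (diagram K) :=
  match A with
  | Atom P ts => @Atom (diagram K) P (map_tuple (@embed_term L K) ts)
  | Def t => Def (embed_term K t)
  | Not B => Not (embed K B)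
  | And B C => And (embed K B) (embed K C)
  | Or B C => Or (embed K B) (embed K C)
  | Imp B C => Imp (embed K B) (embed K C)
  | All x B => All x (embed K B)
  | Ex x B => Ex x (embed K B)
  end.

Definition ihat (L : language) (K : structure L) (c : const (diagram K))
    (w : world K) : option (elem K) :=
  match c with
  | inl c => icst c w
  | inr u => if `[< dom w (sval u) >] then Some (sval u) else None
  end.

(* The value on variables is irrelevant: v is only used on sentences. *)
Definition denot (L : language) (K : structure L) (t : term (diagram K))
    (w : world K) : option (elem K) :=
  if t is Cst c then ihat c w else None.

Fixpoint fsize (L : language) (A : formula L) : nat :=
  match A with
  | Atom _ _ | Def _ => 1
  | Not B | All _ B | Ex _ B => (fsize B).+1
  | And B C | Or B C | Imp B C => (fsize B + fsize C).+1
  end.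

(* The clauses of the induced valuation are recursive in the size of the
   formula rather than structurally, since they substitute constants in
   quantified formulas and push negations inwards; n bounds the recursion
   depth.  See [val_And] .. [val_NotEx] for the clauses without it. *)
Fixpoint val_rec (L : language) (K : structure L) (n : nat)
    (A : formula (diagram K)) (w : world K) {struct n} : Prop :=
  if n isn't n'.+1 then False else
  match A with
  | Atom P ts => exists2 s : (arityE P).-tuple (elem K),
      (forall i, denot (tnth ts i) w = Some (tnth s i)) & @pposE L K P w s
  | Def t => exists a, denot t w = Some a
  | And B C => val_rec n' B w /\ val_rec n' C w
  | Or B C => val_rec n' B w \/ val_rec n' C w
  | Imp B C => forall w', le w w' -> val_rec n' B w' -> val_rec n' C w'
  | All x B => forall w', le w w' -> forall a (ha : dom w' a),
      val_rec n' (subst (bar ha) x B) w'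
  | Ex x B => exists a, exists ha : dom w a, val_rec n' (subst (bar ha) x B) w
  | Not (Atom P ts) => exists2 s : (arityE P).-tuple (elem K),
      (forall i, denot (tnth ts i) w = Some (tnth s i)) & @pnegE L K P w s
  | Not (Def t) => denot t w = None
  | Not (Not B) => val_rec n' B w
  | Not (And B C) => val_rec n' (Not B) w \/ val_rec n' (Not C) w
  | Not (Or B C) => val_rec n' (Not B) w /\ val_rec n' (Not C) w
  | Not (Imp B C) => val_rec n' B w /\ val_rec n' (Not C) w
  | Not (All x B) => exists a, exists ha : dom w a,
      val_rec n' (Not (subst (bar ha) x B)) w
  | Not (Ex x B) => forall w', le w w' -> forall a (ha : dom w' a),
      val_rec n' (Not (subst (bar ha) x B)) w'
  end.

Definition val (L : language) (K : structure L) (A : formula (diagram K))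
    (w : world K) : Prop :=
  val_rec (fsize A) A w.

Definition forces (L : language) (K : structure L) (w : world K)
    (A : formula L) : Prop :=
  val (embed K A) w.

Definition entails (L : language) (G : set (formula L)) (A : formula L) :=
  forall (K : model L) (w : world K),
    (forall B, G B -> forces w B) -> forces w A.

Lemma subst_sentence (L : language) (c : const L) x (A : formula L) :
  (forall y, y != x -> ~~ free y A) -> sentence (subst c x A).
Proof.
suff H y : free y (subst c x A) = (y != x) && free y A.
  by move=> hA y; rewrite H; case: eqVneq => //= /hA.
have Ht (t : term L) : is_var y (subst_term c x t) = (y != x) && is_var y t.
  case: t => [z|d] /=; rewrite /subst_term /= ?andbF //.
  case: (eqVneq z x) => [->|zx] /=; first by rewrite eq_sym; case: eqP.
  by case: (eqVneq z y) zx => [->|] /=; rewrite ?andbF ?andbT // => ->.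
elim: A => [P ts|t|B IH|B IHB C IHC|B IHB C IHC|B IHB C IHC|z B IH|z B IH] //=;
  rewrite -?andb_orr ?IHB ?IHC -?andb_orr //.
- rewrite has_map (eq_has Ht); elim: (tval ts) => [|t s IH] /=.
    by rewrite andbF.
  by rewrite IH andb_orr.
- case: (eqVneq z x) => [->|zx]; last by rewrite IH andbCA.
  by rewrite eq_sym; case: eqP.
- case: (eqVneq z x) => [->|zx]; last by rewrite IH andbCA.
  by rewrite eq_sym; case: eqP.
Qed.

Lemma sentence_subst (L : language) (c : const L) x (A : formula L) :
  sentence (subst c x A) -> forall y, y != x -> ~~ free y A.
Proof.
suff H y : y != x -> free y A -> free y (subst c x A).
  by move=> hA y yx; apply: contra (hA y); exact: H.
move=> yx.
have Ht (t : term L) : is_var y t -> is_var y (subst_term c x t).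
  by case: t => [z|d] //= /eqP ->; rewrite /subst_term /= (negbTE yx) /= eqxx.
elim: A => [P ts|t|B IH|B IHB C IHC|B IHB C IHC|B IHB C IHC|z B IH|z B IH] //=;
  try by [apply: Ht | move=> /orP[/IHB|/IHC] ->; rewrite ?orbT].
- by rewrite has_map; exact: sub_has.
- by move=> /andP[-> hB]; case: eqP => //= _; exact: IH.
- by move=> /andP[-> hB]; case: eqP => //= _; exact: IH.
Qed.

Lemma deduction_sentence (L : language) H (A : formula L) :
  deduction H A -> sentence A.
Proof.
have P2 A1 A2 : sentence A1 -> sentence A2 ->
    forall x, ~~ (free x A1 || free x A2).
  by move=> h1 h2 x; rewrite negb_or h1 h2.
have PE A1 A2 : (forall x, ~~ (free x A1 || free x A2)) ->
    sentence A1 /\ sentence A2.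
  by move=> h; split=> x; have := h x; rewrite negb_or => /andP[].
have Q c x (B : formula L) : sentence (subst c x B) ->
    forall y, ~~ ((x != y) && free y B).
  move=> /sentence_subst h y; case: (eqVneq x y) => //= xy.
  by apply: h; rewrite eq_sym.
have QE c x (B : formula L) : (forall y, ~~ ((x != y) && free y B)) ->
    sentence (subst c x B).
  move=> h; apply: subst_sentence => y yx.
  by have := h y; rewrite eq_sym yx.
elim=> {H A} //=;
  try by [move=> * ; apply: P2 | move=> * x; rewrite /= ?orbT].
all: try by move=> H A B _ /PE[].
all: try by move=> *; exact: (Q _ _ _ ltac:(eassumption)).
all: try by move=> *; apply: QE; eassumption.
- by move=> H1 H2 c1 c2 x A _ _ /Q h _ _; exact: QE.
- by move=> H1 H2 A B _ /PE[].
Qed.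

Lemma fsize_subst (L : language) (c : const L) x (A : formula L) :
  fsize (subst c x A) = fsize A.
Proof.
by elim: A => //= [A ->|A -> B ->|A -> B ->|A -> B ->|y A IH|y A IH] //;
  case: eqP => //; rewrite IH.
Qed.

Lemma val_recE (L : language) (K : structure L) n (A : formula (diagram K)) w :
  fsize A <= n -> val_rec n A w = val A w.
Proof.
suff aux m : fsize A <= m -> fsize A <= n -> val_rec n A w = val_rec m A w.
  by move=> hn; apply: aux.
elim: n m A w => [|n IH] [|m] A w //; try by case: A.
have E (B : formula (diagram K)) (u : world K) : fsize B <= m -> fsize B <= n -> val_rec n B u = val_rec m B u.
  by move=> hm hn; exact: IH.
have split (B C : formula (diagram K)) k : fsize B + fsize C < k.+1 -> fsize B <= k /\ fsize C <= k.
  by rewrite ltnS => h; split; apply: leq_trans h; rewrite ?leq_addr ?leq_addl.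
have splitN (B C : formula (diagram K)) k : (fsize B + fsize C).+1 < k.+1 ->
    [/\ fsize B < k, fsize C < k, fsize B <= k & fsize C <= k].
  rewrite ltnS => h; suff [h1 h2] : fsize B < k /\ fsize C < k.
    by split=> //; exact: ltnW.
  by split; apply: leq_trans h; rewrite ltnS ?leq_addr ?leq_addl.
case: A => [P ts|t|A|A B|A B|A B|x A|x A] //= hm hn.
- case: A hm hn => [P ts|t|A|A B|A B|A B|x A|x A] //= hm hn.
  + by rewrite E // -ltnS ltnW.
  + by have [? ? _ _] := splitN _ _ _ hm; have [? ? _ _] := splitN _ _ _ hn;
      rewrite !E.
  + by have [? ? _ _] := splitN _ _ _ hm; have [? ? _ _] := splitN _ _ _ hn;
      rewrite !E.
  + by have [? ? ? ?] := splitN _ _ _ hm; have [? ? ? ?] := splitN _ _ _ hn;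
      rewrite !E.
  + by congr ex; apply/funext => a; congr ex; apply/funext => ha;
      rewrite E //= fsize_subst.
  + apply/propext; split=> H w' ww' a ha; move: (H w' ww' a ha);
      by rewrite E //= fsize_subst.
- by have [? ?] := split _ _ _ hm; have [? ?] := split _ _ _ hn; rewrite !E.
- by have [? ?] := split _ _ _ hm; have [? ?] := split _ _ _ hn; rewrite !E.
- have [? ?] := split _ _ _ hm; have [? ?] := split _ _ _ hn.
  by apply/propext; split=> H w' ww'; move: (H w' ww'); rewrite !E.
- apply/propext; split=> H w' ww' a ha; move: (H w' ww' a ha);
    by rewrite E ?fsize_subst.
- by congr ex; apply/funext => a; congr ex; apply/funext => ha;
    rewrite E ?fsize_subst.
Qed.

Section Clauses.
Variables (L : language) (K : structure L).
Implicit Types (A B : formula (diagram K)) (w : world K).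

Lemma val_And A B w :
  val (And A B) w = (val A w /\ val B w).
Proof.
rewrite -(@val_recE _ _ (fsize A + fsize B) A) -?(@val_recE _ _ (fsize A + fsize B) B) //.
- by rewrite /= ?ltnS ?leqW ?leq_addl.
- by rewrite /= ?ltnS ?leqW ?leq_addr.
Qed.

Lemma val_Or A B w :
  val (Or A B) w = (val A w \/ val B w).
Proof.
rewrite -(@val_recE _ _ (fsize A + fsize B) A) -?(@val_recE _ _ (fsize A + fsize B) B) //.
- by rewrite /= ?ltnS ?leqW ?leq_addl.
- by rewrite /= ?ltnS ?leqW ?leq_addr.
Qed.

Lemma val_Imp A B w :
  val (Imp A B) w = (forall w', le w w' -> val A w' -> val B w').
Proof.
by apply/propext; split=> H w' ww'; have := H w' ww';
  rewrite -(@val_recE _ _ (fsize A + fsize B) A) ?leq_addr //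
    -(@val_recE _ _ (fsize A + fsize B) B) ?leq_addl.
Qed.

Lemma val_All x A w : val (All x A) w =
  (forall w', le w w' -> forall a (ha : dom w' a), val (subst (bar ha) x A) w').
Proof.
by apply/propext; split=> H w' ww' a ha; have := H w' ww' a ha;
  rewrite /val fsize_subst.
Qed.

Lemma val_Ex x A w : val (Ex x A) w =
  (exists a, exists ha : dom w a, val (subst (bar ha) x A) w).
Proof.
by apply/propext; split=> -[a [ha H]]; exists a, ha; move: H;
  rewrite /val fsize_subst.
Qed.

Lemma val_NotNot A w : val (Not (Not A)) w = val A w.
Proof. by rewrite -(@val_recE _ _ (fsize A).+1 A). Qed.

Lemma val_NotAnd A B w :
  val (Not (And A B)) w = (val (Not A) w \/ val (Not B) w).
Proof.
rewrite -(@val_recE _ _ (fsize A + fsize B).+1 (Not A)) -?(@val_recE _ _ (fsize A + fsize B).+1 (Not B)) //.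
- by rewrite /= ?ltnS ?leqW ?leq_addl.
- by rewrite /= ?ltnS ?leqW ?leq_addr.
Qed.

Lemma val_NotOr A B w :
  val (Not (Or A B)) w = (val (Not A) w /\ val (Not B) w).
Proof.
rewrite -(@val_recE _ _ (fsize A + fsize B).+1 (Not A)) -?(@val_recE _ _ (fsize A + fsize B).+1 (Not B)) //.
- by rewrite /= ?ltnS ?leqW ?leq_addl.
- by rewrite /= ?ltnS ?leqW ?leq_addr.
Qed.

Lemma val_NotImp A B w :
  val (Not (Imp A B)) w = (val A w /\ val (Not B) w).
Proof.
rewrite -(@val_recE _ _ (fsize A + fsize B).+1 A) -?(@val_recE _ _ (fsize A + fsize B).+1 (Not B)) //.
- by rewrite /= ?ltnS ?leqW ?leq_addl.
- by rewrite /= ?ltnS ?leqW ?leq_addr.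
Qed.

Lemma val_NotAll x A w : val (Not (All x A)) w =
  (exists a, exists ha : dom w a, val (Not (subst (bar ha) x A)) w).
Proof.
by apply/propext; split=> -[a [ha H]]; exists a, ha; move: H;
  rewrite /val [fsize (Not (subst _ _ _))]/= fsize_subst.
Qed.

Lemma val_NotEx x A w : val (Not (Ex x A)) w =
  (forall w', le w w' -> forall a (ha : dom w' a),
    val (Not (subst (bar ha) x A)) w').
Proof.
by apply/propext; split=> H w' ww' a ha; have := H w' ww' a ha;
  rewrite /val [fsize (Not (subst _ _ _))]/= fsize_subst.
Qed.

End Clauses.

(* Main.v *)
Require Import Defs.
From Stdlib Require List.
From mathcomp Require Import all_boot.
From mathcomp Require Import boolp classical_sets functions cardinality.

Set Implicit Arguments.
Unset Strict Implicit.
Unset Printing Implicit Defensive.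

Local Open Scope classical_set_scope.

(** Soundness is proved for a Tarski-style satisfaction relation with valuations
    of terms, so that an eigenvariable is handled by revaluing it at the current
    stage; it agrees with the induced valuation v on the diagram language.

    For completeness, the language is extended by constants that are trees:
    besides the old constants there is, for each level k, one witness for each
    formula of the extended language.  An underivable sequent whose constants
    have level at most k extends, by Zorn's lemma, to a prime theory with
    witnesses of level k + 1.  Theories of bounded level, ordered by inclusion,
    are the stages of the canonical model, and the bound leaves fresh constants
    for the universal quantifier and for further extensions.  Derivability in
    the extended language is conservative since any map of constants carries
    deductions to deductions. *)

(** The set of hypotheses may use up every constant of the language, so eigenvariables for
    completeness must come from a larger one. A witness for each formula of a language that already
    contains the witnesses is a circular demand; trees meet it in one step, because a formula is
    itself encoded as a tree.

    The definedness rules shape the notion of theory. PEM gives Dc or ~Dc for every constant c, so a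
    theory closed under all its consequences would contain every constant and leave none for an
    eigenvariable. Closure is therefore relative to the constants that occur in the theory. For the
    constants of the original language the same instances are wanted: each theory decides Dc, and
    hence the interpretation of c does not change from a theory to a larger one.

    Negation has no uniform clause, so every correspondence between formulas and truth is proved for
    A and Not A together, by induction on the size of A, since instances of quantified formulas are
    not subformulas. *)

Definition term_in (M : language) (A : formula M) (t : term M) : Prop :=
  match t with Var x => free x A | Cst c => occurs c A end.

Definition upd (T V : Type) (r : T -> V) (t : T) (v : V) : T -> V :=
  fun u => if `[< u = t >] then v else r u.

Lemma upd_eq T V (r : T -> V) t v : upd r t v t = v.
Proof. by rewrite /upd; case: asboolP. Qed.

Lemma upd_neq T V (r : T -> V) t v u : u <> t -> upd r t v u = r u.
Proof. by rewrite /upd; case: asboolP. Qed.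

Lemma upd_upd T V (r : T -> V) t v v' : upd (upd r t v) t v' = upd r t v'.
Proof. by apply/funext => u; rewrite /upd; case: asboolP. Qed.

Lemma updC T V (r : T -> V) t t' v v' : t <> t' ->
  upd (upd r t v) t' v' = upd (upd r t' v') t v.
Proof.
move=> tt'; apply/funext => u; rewrite /upd.
by case: asboolP => [->|//]; case: asboolP => // /esym.
Qed.

(** Stated for [And], but [term_in] computes to the same proposition on [Or] and [Imp], where this
    lemma and the next also serve. *)
Lemma term_inl (M : language) (B C : formula M) t :
  term_in B t -> term_in (And B C) t.
Proof. by case: t => [x|c] /= h; [rewrite h|left]. Qed.

Lemma term_inr (M : language) (B C : formula M) t :
  term_in C t -> term_in (And B C) t.
Proof. by case: t => [x|c] /= h; [rewrite h orbT|right]. Qed.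

(** * Two-sided satisfaction over an arbitrary frame *)

Section Satisfaction.
Variables (M : language) (W : Type) (le : W -> W -> Prop) (E : Type).
Variables (dom : W -> set E).
Variable ext : bool -> forall P : predE M, W -> set ((arityE P).-tuple E).
Hypothesis le_refl : forall w, le w w.
Hypothesis le_trans : forall u v w, le u v -> le v w -> le u w.

Local Notation assignment := (term M -> W -> option E).

(* [sat p A r w]: A is verified (p = true) or falsified (p = false) at w, the
   terms being valued by r.  The value of a term may change with the world,
   as that of the constants of the diagram does. *)
Fixpoint sat (p : bool) (A : formula M) (r : assignment) (w : W) : Prop :=
  match A with
  | Atom P ts => exists2 s : (arityE P).-tuple E,
      (forall i, r (tnth ts i) w = Some (tnth s i)) & ext p w s
  | Def t => if p then exists a, r t w = Some a else r t w = None
  | Not B => sat (~~ p) B r w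
  | And B C => if p then sat p B r w /\ sat p C r w
               else sat p B r w \/ sat p C r w
  | Or B C => if p then sat p B r w \/ sat p C r w
              else sat p B r w /\ sat p C r w
  | Imp B C => if p then
                   forall w', le w w' -> sat true B r w' -> sat true C r w'
               else sat true B r w /\ sat false C r w
  | All x B => if p then forall w', le w w' -> forall a, dom w' a ->
                   sat p B (upd r (Var x) (fun=> Some a)) w'
               else exists2 a, dom w a &
                   sat p B (upd r (Var x) (fun=> Some a)) w
  | Ex x B => if p then exists2 a, dom w a &
                   sat p B (upd r (Var x) (fun=> Some a)) w
              else forall w', le w w' -> forall a, dom w' a ->
                   sat p B (upd r (Var x) (fun=> Some a)) w'
  end.

Lemma term_in_quant x (B : formula M) t :
  term_in B t -> t = Var x \/ term_in (All x B) t /\ term_in (Ex x B) t.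
Proof.
case: t => [y|c] /= h; last by right.
by case: (eqVneq y x) => [->|yx]; [left|right; rewrite h].
Qed.

(** Agreement is required at all later stages because [Imp], verified [All] and falsified [Ex] look
    upwards. The antecedent of an implication is contravariant, so the induction hypothesis is used
    with r and r' exchanged. *)
Lemma sat_ext_imp p (A : formula M) (r r' : assignment) w :
  (forall t w', le w w' -> term_in A t -> r t w' = r' t w') ->
  sat p A r w -> sat p A r' w.
Proof.
elim: A p r r' w => [P ts|t|B IH|B IHB C IHC|B IHB C IHC|B IHB C IHC|x B IH|x B IH]
  p r r' w h /=.
- case=> s hs hp; exists s => // i; rewrite -hs; apply/esym/h => //=.
  case E1: (tnth ts i) => [y|c] /=; last by exists i.
  by apply/has_tnthP; exists i; rewrite E1 /=.
- by case: p; rewrite (h t w) //=; case: t {h} => /=.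
- exact: IH.
- have hB t w' : le w w' -> term_in B t -> r t w' = r' t w'.
    by move=> ww' ht; apply: h => //; exact: (term_inl C).
  have hC t w' : le w w' -> term_in C t -> r t w' = r' t w'.
    by move=> ww' ht; apply: h => //; exact: (term_inr B).
  by case: p => -[]; [split|left|right]; eauto.
- have hB t w' : le w w' -> term_in B t -> r t w' = r' t w'.
    by move=> ww' ht; apply: h => //; exact: (term_inl C).
  have hC t w' : le w w' -> term_in C t -> r t w' = r' t w'.
    by move=> ww' ht; apply: h => //; exact: (term_inr B).
  by case: p => -[]; [left|right|split]; eauto.
- have hB t w' : le w w' -> term_in B t -> r t w' = r' t w'.
    by move=> ww' ht; apply: h => //; exact: (term_inl C).
  have hC t w' : le w w' -> term_in C t -> r t w' = r' t w'.
    by move=> ww' ht; apply: h => //; exact: (term_inr B).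
  case: p => [H w' ww' Bw'|[]]; last by split; eauto.
  apply: (IHC true r) (H w' ww' _) => [t w'' ?|]; first exact: hC (le_trans ww' _).
  by apply: (IHB true r') Bw' => t w'' ? ?; rewrite hB //; exact: le_trans ww' _.
- have H w' a t w'' : le w w' -> le w' w'' -> term_in B t ->
      upd r (Var x) (fun=> Some a) t w'' = upd r' (Var x) (fun=> Some a) t w''.
    move=> ww' ww'' /(@term_in_quant x) [->|[ht _]]; first by rewrite !upd_eq.
    rewrite /upd; case: asboolP => // _; apply: h => //; exact: le_trans ww' _.
  case: p => [Hs w' ww' a da|[a da Ha]].
    by apply: IH (Hs w' ww' a da) => t w'' ? ?; apply: (H w').
  by exists a => //; apply: IH Ha => t w'' ? ?; apply: (H w).
- have H w' a t w'' : le w w' -> le w' w'' -> term_in B t ->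
      upd r (Var x) (fun=> Some a) t w'' = upd r' (Var x) (fun=> Some a) t w''.
    move=> ww' ww'' /(@term_in_quant x) [->|[_ ht]]; first by rewrite !upd_eq.
    rewrite /upd; case: asboolP => // _; apply: h => //; exact: le_trans ww' _.
  case: p => [[a da Ha]|Hs w' ww' a da].
    by exists a => //; apply: IH Ha => t w'' ? ?; apply: (H w).
  by apply: IH (Hs w' ww' a da) => t w'' ? ?; apply: (H w').
Qed.

Lemma sat_ext p (A : formula M) (r r' : assignment) w :
  (forall t w', le w w' -> term_in A t -> r t w' = r' t w') ->
  sat p A r w <-> sat p A r' w.
Proof.
by move=> h; split; apply: sat_ext_imp => // t w' ? ?; rewrite h.
Qed.

(** The variable receives the whole function [r (Cst c)] of stages, not its value at w; this makes
    the equation hold for undefined and for varying constants alike. *)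
Lemma sat_subst p (A : formula M) c x (r : assignment) w :
  sat p (subst c x A) r w = sat p A (upd r (Var x) (r (Cst c))) w.
Proof.
have Ht t (q : assignment) : q (subst_term c x t) = upd q (Var x) (q (Cst c)) t.
  case: t => [y|d]; rewrite /subst_term /=; last by rewrite upd_neq.
  by case: eqP => [->|yx]; rewrite ?upd_eq ?upd_neq // => -[].
have Hq y (B : formula M) (q : assignment) a :
    (forall p q w, sat p (subst c x B) q w =
      sat p B (upd q (Var x) (q (Cst c))) w) ->
    forall p w, sat p (if y == x then B else subst c x B) (upd q (Var y) a) w =
    sat p B (upd (upd q (Var x) (q (Cst c))) (Var y) a) w.
  move=> IH p' w'; case: eqP => [->|yx]; first by rewrite upd_upd.
  by rewrite IH [in LHS]updC ?(@upd_neq _ _ _ _ _ (Cst c)) //; case.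
elim: A p r w => [P ts|t|B IH|B IHB C IHC|B IHB C IHC|B IHB C IHC|y B IH|y B IH]
  p r w /=.
- apply/propext; split=> -[s hs hp]; exists s => // i; move: (hs i);
    by rewrite tnth_map Ht.
- by rewrite Ht.
- by rewrite IH.
- by rewrite IHB IHC.
- by rewrite IHB IHC.
- case: p; last by rewrite IHB IHC.
  by apply/propext; split=> H w' ww'; move: (H w' ww'); rewrite IHB IHC.
- case: p.
    by apply/propext; split=> H w' ww' a da; move: (H w' ww' a da); rewrite Hq.
  by apply/propext; split=> -[a da H]; exists a => //; move: H; rewrite Hq.
- case: p.
    by apply/propext; split=> -[a da H]; exists a => //; move: H; rewrite Hq.
  by apply/propext; split=> H w' ww' a da; move: (H w' ww' a da); rewrite Hq.
Qed.

Hypothesis dom_mono : forall w w', le w w' -> dom w `<=` dom w'.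
Hypothesis ext_mono : forall p (P : predE M) w w', le w w' ->
  @ext p P w `<=` @ext p P w'.

(** Persistence is asked from w upwards only: a constant of the diagram has no value before its
    element enters the domain. *)
Definition stable_above (r : assignment) w :=
  forall t w', le w w' -> r t w' = r t w.

Lemma stable_above_upd (r : assignment) w t a :
  stable_above r w -> stable_above (upd r t (fun=> Some a)) w.
Proof. by move=> h u w' ww'; rewrite /upd; case: asboolP => // _; exact: h. Qed.

Lemma stable_above_le (r : assignment) w w' :
  stable_above r w -> le w w' -> stable_above r w'.
Proof. by move=> h ww' u v hv; rewrite !h //; exact: le_trans ww' _. Qed.

Lemma sat_mono p (A : formula M) (r : assignment) w w' :
  stable_above r w -> le w w' -> sat p A r w -> sat p A r w'.
Proof.
elim: A p r w w' => [P ts|t|B IH|B IHB C IHC|B IHB C IHC|B IHB C IHC|x B IH|x B IH]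
  p r w w' h ww' /=.
- by case=> s hs hp; exists s; [move=> i; rewrite h //|exact: ext_mono hp].
- by rewrite h.
- exact: IH.
- by case: p => -[]; [split|left|right]; eauto.
- by case: p => -[]; [left|right|split]; eauto.
- case: p => [H v wv|[]]; last by split; eauto.
  by apply: H; exact: le_trans wv.
- case: p => [H v wv|[a da H]]; first by apply: H; exact: le_trans wv.
  by exists a; [exact: dom_mono da|apply: IH H => //; exact: stable_above_upd].
- case: p => [[a da H]|H v wv]; last by apply: H; exact: le_trans wv.
  by exists a; [exact: dom_mono da|apply: IH H => //; exact: stable_above_upd].
Qed.

End Satisfaction.

(** * Derivability *)

Section Provability.
Variable L : language.
Implicit Types (A B C : formula L) (G H : set (formula L)).

(** Finiteness is what makes fresh constants available, and what places the hypotheses of a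
    deduction inside a single member of a chain. *)
Lemma deduction_finite H A : deduction H A ->
  exists l : seq (formula L), forall B, H B -> List.In B l.
Proof.
have U (H1 H2 : set (formula L)) :
    (exists l, forall B, H1 B -> List.In B l) ->
    (exists l, forall B, H2 B -> List.In B l) ->
    exists l, forall B, (H1 `|` H2) B -> List.In B l.
  move=> [l1 h1] [l2 h2]; exists (l1 ++ l2) => B hB.
  by apply/List.in_or_app; case: hB => [/h1|/h2]; [left|right].
have D (H1 H2 : set (formula L)) :
    (exists l, forall B, H1 B -> List.In B l) ->
    exists l, forall B, (H1 `\` H2) B -> List.In B l.
  by move=> [l h]; exists l => B [/h].
elim=> {H A}; try by move=> *; first [assumption | apply: U | apply: D].
- by move=> A _; exists [:: A] => B ->; left.
- move=> H H1 H2 A B C _ h _ h1 _ h2.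
  exact: (U _ _ (U _ _ h (D _ _ h1)) (D _ _ h2)).
- move=> H H1 H2 A B C _ h _ h1 _ h2.
  exact: (U _ _ (U _ _ h (D _ _ h1)) (D _ _ h2)).
- by move=> c; exists [::] => B [].
- by move=> H1 H2 c x A B _ h1 _ h2 _ _ _; apply: (U _ _ h1 (D _ _ (D _ _ h2))).
- by move=> H1 H2 c x A B _ h1 _ h2 _ _ _; apply: (U _ _ h1 (D _ _ (D _ _ h2))).
Qed.

Lemma occurs_finite A :
  exists l : seq (const L), forall c, occurs c A -> List.In c l.
Proof.
have H (t : term L) : exists l : seq (const L), forall c, t = Cst c -> List.In c l.
  by case: t => [x|c]; [exists [::]|exists [:: c] => d [->]; left].
have U (P Q : const L -> Prop) :
    (exists l, forall c, P c -> List.In c l) ->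
    (exists l, forall c, Q c -> List.In c l) ->
    exists l, forall c, P c \/ Q c -> List.In c l.
  move=> [l1 h1] [l2 h2]; exists (l1 ++ l2) => c hc.
  by apply/List.in_or_app; case: hc => [/h1|/h2]; [left|right].
elim: A => //= [P ts|B hB C hC|B hB C hC|B hB C hC]; try exact: U.
have [l hl] : exists l : seq (const L),
    forall c, List.In (Cst c) ts -> List.In c l.
  elim: (tval ts) => [|t s [l hl]]; first by exists [::].
  have [l' hl'] := H t; exists (l' ++ l) => c hc.
  by apply/List.in_or_app; case: hc => [/hl'|/hl]; [left|right].
exists l => c [i hi]; apply: hl; rewrite -hi (tnth_nth (Cst c)).
have: i < size ts by rewrite size_tuple.
elim: (tval ts) (nat_of_ord i) => [|t s IH] [|j] //=; first by left.
by move/IH; right.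
Qed.

Lemma fresh_const (l : seq (const L)) : exists c, ~ List.In c l.
Proof.
apply: contrapT => h; apply: (@const_infinite L).
have: [set: const L] `<=` [set c | List.In c l].
  by move=> c _ /=; apply: contrapT => nc; apply: h; exists c.
move=> /sub_finite_set; apply; elim: l {h} => [|d l IH] /=.
  by rewrite (_ : [set _ | _] = set0) //; apply/seteqP; split.
rewrite (_ : [set _ | _] = [set d] `|` [set c | List.In c l]).
  by rewrite finite_setU; split.
by apply/seteqP; split=> c /= [->|hc]; [left|right|left|right].
Qed.

Lemma fresh_formulas (l : seq (formula L)) :
  exists c, forall B, List.In B l -> ~ occurs c B.
Proof.
suff [l' h] : exists l' : seq (const L),
    forall B c, List.In B l -> occurs c B -> List.In c l'.
  by have [c hc] := fresh_const l'; exists c => B hB /(h _ _ hB).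
elim: l => [|B l [l1 h1]]; first by exists [::].
have [l2 h2] := occurs_finite B; exists (l2 ++ l1) => B' c hB hc.
by apply/List.in_or_app; case: hB hc => [<- /h2|/h1 h /h]; [left|right].
Qed.

Lemma provable_hyp G A : sentence A -> G A -> provable G A.
Proof. by move=> sA GA; exists [set A]; [move=> _ ->|exact: d_hyp]. Qed.

Lemma provable_mono G G' A : G `<=` G' -> provable G A -> provable G' A.
Proof. by move=> GG [H HG d]; exists H => //; exact: subset_trans GG. Qed.

Lemma provable_sentence G A : provable G A -> sentence A.
Proof. by move=> [H _ /deduction_sentence]. Qed.

Lemma provable1 G A B : (forall H, deduction H A -> deduction H B) ->
  provable G A -> provable G B.
Proof. by move=> h [H HG d]; exists H => //; exact: h. Qed.

Lemma provable2 G A B C :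
  (forall H1 H2, deduction H1 A -> deduction H2 B -> deduction (H1 `|` H2) C) ->
  provable G A -> provable G B -> provable G C.
Proof.
move=> h [H1 h1 d1] [H2 h2 d2]; exists (H1 `|` H2); last exact: h.
by move=> D [/h1|/h2].
Qed.

Lemma subset_discharge H G A : H `<=` A |` G -> H `\` [set A] `<=` G.
Proof. by move=> h B [/h[]]. Qed.

Lemma provable_orE G A B C : provable G (Or A B) ->
  provable (A |` G) C -> provable (B |` G) C -> provable G C.
Proof.
move=> [H h d] [H1 h1 d1] [H2 h2 d2].
exists (H `|` (H1 `\` [set A]) `|` (H2 `\` [set B])); last exact: d_orE.
by rewrite !subUset; split; [split|]; [|exact: subset_discharge..].
Qed.

Lemma provable_nandE G A B C : provable G (Not (And A B)) ->
  provable (Not A |` G) C -> provable (Not B |` G) C -> provable G C.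
Proof.
move=> [H h d] [H1 h1 d1] [H2 h2 d2].
exists (H `|` (H1 `\` [set Not A]) `|` (H2 `\` [set Not B])); last exact: d_nandE.
by rewrite !subUset; split; [split|]; [|exact: subset_discharge..].
Qed.

Lemma provable_impI G A B : sentence A ->
  provable (A |` G) B -> provable G (Imp A B).
Proof.
move=> sA [H h d]; exists (H `\` [set A]); last exact: d_impI.
exact: subset_discharge.
Qed.

Lemma provable_impE G A B : provable G (Imp A B) -> provable G A -> provable G B.
Proof. by apply: provable2 => H1 H2; exact: d_impE. Qed.

Lemma provable_cut G A B : provable G A -> provable (A |` G) B -> provable G B.
Proof.
move=> hA hB; apply: provable_impE (hA); apply: provable_impI hB.
exact: provable_sentence hA.
Qed.

Lemma provable_allI G c x A : ~ occurs c A -> fresh_for c G ->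
  provable (Def (Cst c) |` G) (subst c x A) -> provable G (All x A).
Proof.
move=> nc hc [H h d]; have hG := subset_discharge h.
by exists (H `\` [set Def (Cst c)]) => //; apply: d_allI => // B /hG /hc.
Qed.

Lemma provable_nexI G c x A : ~ occurs c A -> fresh_for c G ->
  provable (Def (Cst c) |` G) (Not (subst c x A)) -> provable G (Not (Ex x A)).
Proof.
move=> nc hc [H h d]; have hG := subset_discharge h.
by exists (H `\` [set Def (Cst c)]) => //; apply: d_nexI => // B /hG /hc.
Qed.

Lemma provable_exE G c x A B : ~ occurs c A -> ~ occurs c B -> fresh_for c G ->
  provable G (Ex x A) ->
  provable (subst c x A |` (Def (Cst c) |` G)) B -> provable G B.
Proof.
move=> ncA ncB hc [H1 h1 d1] [H2 h2 d2].
have hG := subset_discharge (subset_discharge h2).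
exists (H1 `|` (H2 `\` [set subst c x A] `\` [set Def (Cst c)])).
  by rewrite subUset.
by apply: d_exE => // D /hG /hc.
Qed.

Lemma provable_nallE G c x A B : ~ occurs c A -> ~ occurs c B -> fresh_for c G ->
  provable G (Not (All x A)) ->
  provable (Not (subst c x A) |` (Def (Cst c) |` G)) B -> provable G B.
Proof.
move=> ncA ncB hc [H1 h1 d1] [H2 h2 d2].
have hG := subset_discharge (subset_discharge h2).
exists (H1 `|` (H2 `\` [set Not (subst c x A)] `\` [set Def (Cst c)])).
  by rewrite subUset.
by apply: d_nallE => // D /hG /hc.
Qed.

End Provability.

(** * Change of constants *)

Section ConstantMaps.
Variables (Pr : Type) (ar : Pr -> nat).
Variables (C C' : Type).
Variables (hC : infinite_set [set: C]) (hC' : infinite_set [set: C']).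
Let M := @Language C Pr ar hC.
Let M' := @Language C' Pr ar hC'.

Definition tmap (f : C -> C') (t : term M) : term M' :=
  match t with Var x => Var x | Cst c => @Cst M' (f c) end.

(** The two languages share [Pr] and [ar], so the predicate letters and arities of [M] are by
    conversion those of [M'] and the argument tuples need no cast. *)
Fixpoint fmap (f : C -> C') (A : formula M) : formula M' :=
  match A with
  | Atom P ts => @Atom M' P (map_tuple (tmap f) ts)
  | Def t => Def (tmap f t)
  | Not B => Not (fmap f B)
  | And B D => And (fmap f B) (fmap f D)
  | Or B D => Or (fmap f B) (fmap f D)
  | Imp B D => Imp (fmap f B) (fmap f D)
  | All x B => All x (fmap f B)
  | Ex x B => Ex x (fmap f B)
  end.

Lemma is_var_tmap f x t : is_var x (tmap f t) = is_var x t.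
Proof. by case: t. Qed.

Lemma free_fmap f x A : free x (fmap f A) = free x A.
Proof.
elim: A => //= [P ts|t|B -> D ->|B -> D ->|B -> D ->|y B ->|y B ->] //;
  last by rewrite is_var_tmap.
by rewrite has_map; apply: eq_has => t; exact: is_var_tmap.
Qed.

Lemma sentence_fmap f A : sentence (fmap f A) <-> sentence A.
Proof. by split=> h x; move: (h x); rewrite free_fmap. Qed.

Lemma subst_tmap f c x t :
  tmap f (subst_term c x t) = subst_term (f c : const M') x (tmap f t).
Proof. by rewrite /subst_term is_var_tmap; case: ifP. Qed.

Lemma fmap_subst f c x A :
  fmap f (subst c x A) = subst (f c : const M') x (fmap f A).
Proof.
elim: A => //= [P ts|t|B ->|B -> D ->|B -> D ->|B -> D ->|y B IH|y B IH] //.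
- by congr Atom; apply: eq_from_tnth => i; rewrite !tnth_map subst_tmap.
- by rewrite subst_tmap.
- by case: eqP => //; rewrite IH.
- by case: eqP => //; rewrite IH.
Qed.

Lemma fmap_ext (f g : C -> C') (A : formula M) :
  (forall c, occurs c A -> f c = g c) -> fmap f A = fmap g A.
Proof.
have Ht (t : term M) : (forall c, t = Cst c -> f c = g c) -> tmap f t = tmap g t.
  by case: t => //= c h; rewrite (h c).
elim: A => //= [P ts|t|B IH|B IHB D IHD|B IHB D IHD|B IHB D IHD|x B IH|x B IH] h.
- congr Atom; apply: eq_from_tnth => i; rewrite !tnth_map; apply: Ht => c hc.
  by apply: h; exists i.
- by rewrite Ht.
- by rewrite IH.
- by rewrite IHB ?IHD // => c hc; apply: h; [right|left].
- by rewrite IHB ?IHD // => c hc; apply: h; [right|left].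
- by rewrite IHB ?IHD // => c hc; apply: h; [right|left].
- by rewrite IH.
- by rewrite IH.
Qed.

Lemma occurs_fmap f A d : occurs d (fmap f A) -> exists2 c, occurs c A & d = f c.
Proof.
have Ht t : tmap f t = Cst d -> exists2 c, t = Cst c & d = f c.
  by case: t => //= c [<-]; exists c.
elim: A => //= [P ts|B IHB D IHD|B IHB D IHD|B IHB D IHD].
- by move=> [i]; rewrite tnth_map => /Ht[c hc e]; exists c => //; exists i.
- by move=> [/IHB|/IHD] [c hc e]; exists c => //; [left|right].
- by move=> [/IHB|/IHD] [c hc e]; exists c => //; [left|right].
- by move=> [/IHB|/IHD] [c hc e]; exists c => //; [left|right].
Qed.

Lemma fmap_atom_cst f (P : predE M) (cs : (arityE P).-tuple (const M)) :
  fmap f (Atom (map_tuple Cst cs)) =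
  @Atom M' P (map_tuple (@Cst M') (map_tuple f cs)).
Proof. by congr Atom; apply: eq_from_tnth => i; rewrite !tnth_map. Qed.

Lemma fmap_Eqn f c d : fmap f (Eqn (Cst c) (Cst d)) =
  Eqn (Cst (f c : const M')) (Cst (f d : const M')).
Proof. by congr Atom; apply: eq_from_tnth => -[[|[|//]] hi]. Qed.

Lemma fmap_eigen f c d x (A : formula M) : ~ occurs c A ->
  fmap (upd f c d) (subst c x A) = subst (d : const M') x (fmap f A).
Proof.
move=> nc; rewrite fmap_subst upd_eq; congr subst; apply: fmap_ext => e he.
by rewrite upd_neq // => ec; apply: nc; rewrite -ec.
Qed.

Lemma fmap_upd_fresh f c d (A : formula M) : ~ occurs c A ->
  fmap (upd f c d) A = fmap f A.
Proof.
move=> nc; apply: fmap_ext => e he.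
by rewrite upd_neq // => ec; apply: nc; rewrite -ec.
Qed.

(* The map need not be injective: the eigenvariables of the deduction are
   renamed to constants that are fresh for the image. *)
Lemma provable_fmap H A : deduction H A -> forall (f : C -> C') G,
  (forall B, H B -> G (fmap f B)) -> provable G (fmap f A).
Proof.
have Il (H1 H2 : set (formula M)) f (G : set (formula M')) :
    (forall B, (H1 `|` H2) B -> G (fmap f B)) -> forall B, H1 B -> G (fmap f B).
  by move=> h B ?; apply: h; left.
have Ir (H1 H2 : set (formula M)) f (G : set (formula M')) :
    (forall B, (H1 `|` H2) B -> G (fmap f B)) -> forall B, H2 B -> G (fmap f B).
  by move=> h B ?; apply: h; right.
have Id (H1 : set (formula M)) A1 f (G : set (formula M')) :
    (forall B, (H1 `\` [set A1]) B -> G (fmap f B)) ->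
    forall B, H1 B -> (fmap f A1 |` G) (fmap f B).
  by move=> h B hB; have [->|ne] := pselect (B = A1); [left|right; apply: h].
have Fr H1 A1 H2 A2 f (B1 B2 : formula M') : deduction H1 A1 -> deduction H2 A2 ->
    exists d : const M', [/\ fresh_for d (fmap f @` H1),
      fresh_for d (fmap f @` H2), ~ occurs d B1 & ~ occurs d B2].
  move=> /deduction_finite [l1 h1] /deduction_finite [l2 h2].
  have [d hd] := fresh_formulas (B1 :: B2 :: List.map (fmap f) (l1 ++ l2)).
  exists d; split; [| |by apply: hd; left|by apply: hd; right; left].
    move=> _ [B hB <-]; apply: hd; do 2 right; apply: List.in_map.
    by apply/List.in_or_app; left; exact: h1.
  move=> _ [B hB <-]; apply: hd; do 2 right; apply: List.in_map.
  by apply/List.in_or_app; right; exact: h2.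
elim=> {H A}.
- by move=> A sA f G hG; apply: provable_hyp; [exact/sentence_fmap|exact: hG].
- move=> H1 H2 A B _ IH1 _ IH2 f G hG.
  apply: provable2 (IH1 f G (Il _ _ _ _ hG)) (IH2 f G (Ir _ _ _ _ hG)) => ? ?.
  exact: d_andI.
- move=> H A B _ IH f G hG; apply: provable1 (IH f G hG) => ?.
  exact: d_andE1.
- move=> H A B _ IH f G hG; apply: provable1 (IH f G hG) => ?.
  exact: d_andE2.
- move=> H A B sB _ IH f G hG; apply: provable1 (IH f G hG) => ?.
  by apply: d_orI1; exact/sentence_fmap.
- move=> H A B sB _ IH f G hG; apply: provable1 (IH f G hG) => ?.
  by apply: d_orI2; exact/sentence_fmap.
- move=> H H1 H2 A B D _ IH _ IH1 _ IH2 f G hG.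
  apply: provable_orE (IH f G (Il _ _ _ _ (Il _ _ _ _ hG))) _ _.
    by apply: IH1; apply: Id; apply: Ir (Il _ _ _ _ hG).
  by apply: IH2; apply: Id; apply: Ir hG.
- move=> H A B sB _ IH f G hG; apply: provable1 (IH f G hG) => ?.
  by apply: d_nandI1; exact/sentence_fmap.
- move=> H A B sB _ IH f G hG; apply: provable1 (IH f G hG) => ?.
  by apply: d_nandI2; exact/sentence_fmap.
- move=> H H1 H2 A B D _ IH _ IH1 _ IH2 f G hG.
  apply: provable_nandE (IH f G (Il _ _ _ _ (Il _ _ _ _ hG))) _ _.
    by apply: IH1; apply: (Id _ (Not A)); apply: Ir (Il _ _ _ _ hG).
  by apply: IH2; apply: (Id _ (Not B)); apply: Ir hG.
- move=> H1 H2 A B _ IH1 _ IH2 f G hG.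
  apply: provable2 (IH1 f G (Il _ _ _ _ hG)) (IH2 f G (Ir _ _ _ _ hG)) => ? ?.
  exact: d_norI.
- move=> H A B _ IH f G hG; apply: provable1 (IH f G hG) => ?.
  exact: d_norE1.
- move=> H A B _ IH f G hG; apply: provable1 (IH f G hG) => ?.
  exact: d_norE2.
- by move=> H A _ IH f G hG; apply: provable1 (IH f G hG) => ?; exact: d_dnI.
- by move=> H A _ IH f G hG; apply: provable1 (IH f G hG) => ?; exact: d_dnE.
- move=> H P cs i _ IH f G hG; apply: provable1 (IH f G hG) => ?.
  by rewrite fmap_atom_cst => /(@d_defI M' _ P _ i); rewrite tnth_map.
- move=> H P cs i _ IH f G hG; apply: provable1 (IH f G hG) => ?.
  rewrite [fmap f _]/= -/(fmap f (Atom _)) fmap_atom_cst.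
  by move=> /(@d_defNI M' _ P _ i); rewrite tnth_map.
- move=> H1 H2 c B sB _ IH1 _ IH2 f G hG.
  apply: provable2 (IH1 f G (Il _ _ _ _ hG)) (IH2 f G (Ir _ _ _ _ hG)) => ? ?.
  by apply: d_pexD; exact/sentence_fmap.
- by move=> c f G _; exists set0 => //; exact: (@d_pemD M' (f c)).
- move=> H c x A dA IH nc hc f G hG.
  have [d [hd _ ndA _]] := Fr _ _ _ _ f (fmap f A) (fmap f A) dA dA.
  (* [G] may mention every constant of [M']; [d] is fresh only for the image of the finitely many
     hypotheses in use, so [G] is first cut down to that image. *)
  apply: (@provable_mono _ (fmap f @` (H `\` [set Def (Cst c)]))).
    by move=> _ [B hB <-]; exact: hG.
  apply: (@provable_allI _ _ d) => //.
    by move=> _ [B [hB _] <-]; apply: hd; exists B.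
  rewrite -(@fmap_eigen f c d) //; apply: IH => B hB.
  have [->|ne] := pselect (B = Def (Cst c)); first by left; rewrite /= upd_eq.
  right; exists B; first by split.
  by rewrite fmap_upd_fresh //; apply: hc; split.
- move=> H1 H2 c x A _ IH1 _ IH2 f G hG; rewrite fmap_subst.
  apply: provable2 (IH1 f G (Il _ _ _ _ hG)) (IH2 f G (Ir _ _ _ _ hG)) => ? ?.
  exact: d_allE.
- move=> H1 H2 c x A _ IH1 _ IH2 f G hG.
  apply: provable2 (IH1 f G (Il _ _ _ _ hG)) (IH2 f G (Ir _ _ _ _ hG)) => ? ?.
  by rewrite fmap_subst; exact: d_exI.
- move=> H1 H2 c x A B d1 IH1 d2 IH2 ncA ncB hc f G hG.
  have [d [hd1 hd2 ndA ndB]] := Fr _ _ _ _ f (fmap f A) (fmap f B) d1 d2.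
  set H2' := H2 `\` _ `\` _ in hc hG.
  apply: (@provable_mono _ (fmap f @` (H1 `|` H2'))).
    by move=> _ [D hD <-]; exact: hG.
  apply: (@provable_exE _ _ d x (fmap f A)) => //.
  - move=> _ [D [hD|[[hD _] _]] <-]; first by apply: hd1; exists D.
    by apply: hd2; exists D.
  - by apply: IH1 => D hD; exists D => //; left.
  - rewrite -(@fmap_eigen f c d) // -(@fmap_upd_fresh f c d B) //.
    apply: IH2 => D hD.
    have [->|ne] := pselect (D = subst c x A); first by left.
    have [->|ne'] := pselect (D = Def (Cst c)).
      by right; left; rewrite /= upd_eq.
    have hD' : H2' D by split; [split|].
    by right; right; exists D; [right|rewrite fmap_upd_fresh //; exact: hc].
- move=> H1 H2 c x A _ IH1 _ IH2 f G hG.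
  apply: provable2 (IH1 f G (Il _ _ _ _ hG)) (IH2 f G (Ir _ _ _ _ hG)) => ? ?.
  by rewrite /= fmap_subst; exact: d_nallI.
- move=> H1 H2 c x A B d1 IH1 d2 IH2 ncA ncB hc f G hG.
  have [d [hd1 hd2 ndA ndB]] := Fr _ _ _ _ f (fmap f A) (fmap f B) d1 d2.
  set H2' := H2 `\` _ `\` _ in hc hG.
  apply: (@provable_mono _ (fmap f @` (H1 `|` H2'))).
    by move=> _ [D hD <-]; exact: hG.
  apply: (@provable_nallE _ _ d x (fmap f A)) => //.
  - move=> _ [D [hD|[[hD _] _]] <-]; first by apply: hd1; exists D.
    by apply: hd2; exists D.
  - by apply: IH1 => D hD; exists D => //; left.
  - rewrite -(@fmap_eigen f c d) // -(@fmap_upd_fresh f c d B) //.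
    apply: IH2 => D hD.
    have [->|ne] := pselect (D = Not (subst c x A)); first by left.
    have [->|ne'] := pselect (D = Def (Cst c)).
      by right; left; rewrite /= upd_eq.
    have hD' : H2' D by split; [split|].
    by right; right; exists D; [right|rewrite fmap_upd_fresh //; exact: hc].
- move=> H c x A dA IH nc hc f G hG.
  have [d [hd _ ndA _]] := Fr _ _ _ _ f (fmap f A) (fmap f A) dA dA.
  apply: (@provable_mono _ (fmap f @` (H `\` [set Def (Cst c)]))).
    by move=> _ [B hB <-]; exact: hG.
  apply: (@provable_nexI _ _ d) => //.
    by move=> _ [B [hB _] <-]; apply: hd; exists B.
  rewrite -(@fmap_eigen f c d) //; apply: IH => B hB.
  have [->|ne] := pselect (B = Def (Cst c)); first by left; rewrite /= upd_eq.
  right; exists B; first by split.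
  by rewrite fmap_upd_fresh //; apply: hc; split.
- move=> H1 H2 c x A _ IH1 _ IH2 f G hG; rewrite /= fmap_subst.
  apply: provable2 (IH1 f G (Il _ _ _ _ hG)) (IH2 f G (Ir _ _ _ _ hG)) => ? ?.
  exact: d_nexE.
- move=> H c _ IH f G hG; rewrite fmap_Eqn.
  by apply: provable1 (IH f G hG) => ?; exact: d_eqI.
- move=> H1 H2 c1 c2 x A hA _ IH1 _ IH2 f G hG.
  have {}IH1 := IH1 f G (Il _ _ _ _ hG); have {}IH2 := IH2 f G (Ir _ _ _ _ hG).
  move: IH1 IH2; rewrite fmap_Eqn !fmap_subst; apply: provable2 => ? ?.
  apply: d_eqE; case: hA => [|[B + ->]] => -[[P [ts ->]]|[t ->]].
  + by left; left; exists P, (map_tuple (tmap f) ts).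
  + by left; right; exists (tmap f t).
  + right; exists (fmap f (Atom ts)) => //.
    by left; exists P, (map_tuple (tmap f) ts).
  + by right; exists (Def (tmap f t)) => //; right; exists (tmap f t).
- move=> H1 H2 c1 c2 x A [P [ts ->]] hx _ IH1 _ IH2 f G hG.
  have {}IH1 := IH1 f G (Il _ _ _ _ hG); have {}IH2 := IH2 f G (Ir _ _ _ _ hG).
  move: IH1 IH2; rewrite [fmap f (Not (Eqn _ _))]/= -/(fmap f (Atom _)) fmap_Eqn.
  have -> : fmap f (Not (subst c2 x (Atom ts))) =
      Not (subst (f c2 : const M') x (fmap f (Atom ts))).
    by rewrite -fmap_subst.
  rewrite fmap_subst.
  apply: provable2 => ? ?; apply: d_neqI; last by rewrite free_fmap.
  by exists P, (map_tuple (tmap f) ts).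
- move=> H A B sA _ IH f G hG; apply: provable_impI; first exact/sentence_fmap.
  by apply: IH; exact: Id.
- move=> H1 H2 A B _ IH1 _ IH2 f G hG.
  apply: provable2 (IH1 f G (Il _ _ _ _ hG)) (IH2 f G (Ir _ _ _ _ hG)) => ? ?.
  exact: d_impE.
- move=> H1 H2 A B _ IH1 _ IH2 f G hG.
  apply: provable2 (IH1 f G (Il _ _ _ _ hG)) (IH2 f G (Ir _ _ _ _ hG)) => ? ?.
  exact: d_nimpI.
- move=> H A B _ IH f G hG; apply: provable1 (IH f G hG) => ?.
  exact: d_nimpE1.
- move=> H A B _ IH f G hG; apply: provable1 (IH f G hG) => ?.
  exact: d_nimpE2.
Qed.

End ConstantMaps.
Arguments tmap {Pr ar C C' hC hC'} f t.
Arguments fmap {Pr ar C C' hC hC'} f A.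

Lemma fmap_cancel (Pr : Type) (ar : Pr -> nat) (C C' : Type)
    (hC : infinite_set [set: C]) (hC' : infinite_set [set: C'])
    (f : C -> C') (g : C' -> C) (A : formula (@Language C Pr ar hC)) :
  cancel f g -> fmap g (fmap f A : formula (@Language C' Pr ar hC')) = A.
Proof.
move=> fg.
have Ht (t : term (@Language C Pr ar hC)) :
    tmap g (tmap f t : term (@Language C' Pr ar hC')) = t.
  by case: t => //= c; rewrite fg.
elim: A => //= [P ts|t|B ->|B -> D ->|B -> D ->|B -> D ->|y B ->|y B ->] //.
  by congr Atom; apply: eq_from_tnth => i; rewrite !tnth_map Ht.
by rewrite Ht.
Qed.

(** * Satisfaction under a change of constants *)

Section SatisfactionMap.
Variables (Pr : Type) (ar : Pr -> nat) (C C' : Type).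
Variables (hC : infinite_set [set: C]) (hC' : infinite_set [set: C']).
Local Notation M := (@Language C Pr ar hC).
Local Notation M' := (@Language C' Pr ar hC').
Variables (W : Type) (le : W -> W -> Prop) (E : Type) (dom : W -> set E).
Variable ext : bool -> forall P : predE M, W -> set ((arityE P).-tuple E).

(** The embeddings of [L] into its diagram language and into the language of trees are both maps of
    constants; each transfer of truth along them is an instance. *)
Lemma sat_fmap p (f : C -> C') (A : formula M) (r : term M' -> W -> option E) w :
  @sat M' W le E dom ext p (fmap f A) r w =
  @sat M W le E dom ext p A (fun t => r (tmap f t)) w.
Proof.
have Hu x a (r' : term M' -> W -> option E) :
    (fun t : term M => upd r' (Var x) a (tmap f t)) =
    upd (fun t => r' (tmap f t)) (Var x) a.
  apply/funext => -[y|c]; rewrite /upd /=; last first.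
    by do 2 case: asboolP => // _.
  case: (eqVneq y x) => [->|yx]; first by do 2 case: asboolP => // _.
  by do 2 (case: asboolP => [[]/eqP|_]; first by rewrite (negbTE yx)).
elim: A p r w => [P ts|t|B IH|B IHB D IHD|B IHB D IHD|B IHB D IHD|x B IH|x B IH]
  p r w //=.
- apply/propext; split=> -[s hs hp]; exists s => // i; move: (hs i);
    by rewrite tnth_map.
- by rewrite IHB IHD.
- by rewrite IHB IHD.
- case: p; last by rewrite IHB IHD.
  by apply/propext; split=> H w' ww'; move: (H w' ww'); rewrite IHB IHD.
- case: p.
    by apply/propext; split=> H w' ww' a da; move: (H w' ww' a da); rewrite IH Hu.
  by apply/propext; split=> -[a da H]; exists a => //; move: H; rewrite IH Hu.
- case: p.
    by apply/propext; split=> -[a da H]; exists a => //; move: H; rewrite IH Hu.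
  by apply/propext; split=> H w' ww' a da; move: (H w' ww' a da); rewrite IH Hu.
Qed.

End SatisfactionMap.

(** * Soundness *)

Definition extension (L : language) (K : structure L) (p : bool)
    (P : predE L) (w : world K) : set ((arityE P).-tuple (elem K)) :=
  if p then pposE P w else pnegE P w.
Arguments extension {L K} p P w _.

Lemma sat_embed (L : language) (K : structure L) p (A : formula L) r w :
  @sat (diagram K) (world K) (@le L K) (elem K) (@dom L K) (@extension L K)
    p (embed K A) r w =
  sat (@le L K) (@dom L K) (@extension L K) p A (fun t => r (embed_term K t)) w.
Proof.
case: L K A r w => C Pr ar hC K A r w.
have -> : embed K A = fmap inl A :> formula (diagram K).
  by elim: A => //= [B ->|B -> D ->|B -> D ->|B -> D ->|x B ->|x B ->].
exact: (@sat_fmap Pr ar C (diagram_const K) hC (@diagram_const_infinite _ K) _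
  (@le _ K) _ (@dom _ K) (@extension _ K) p inl A r w).
Qed.

(** * Agreement with the induced valuation *)

Section ModelSatisfaction.
Variables (L : language) (K : model L).
Local Notation W := (world K).

Definition satL p (A : formula L) r (w : W) :=
  sat (@le L K) (@dom L K) (@extension L K) p A r w.

Definition satD p (A : formula (diagram K)) r (w : W) :=
  @sat (diagram K) W (@le L K) (elem K) (@dom L K) (@extension L K) p A r w.

Let leK_refl := le_refl (modelP K).
Let leK_trans := le_trans (modelP K).

(** [bar ha] denotes nothing at stages that lack a, but satisfaction at w inspects only stages above
    w, and there a persists by [dom_mono]. *)
Lemma bar_sat p (B : formula (diagram K)) x (w : W) a (ha : dom w a) :
  satD p (subst (bar ha) x B) (@denot L K) w <->
  satD p B (upd (@denot L K) (Var x) (fun=> Some a)) w.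
Proof.
rewrite /satD sat_subst; apply: sat_ext => //.
move=> t w' ww' _; rewrite /upd; case: asboolP => // _ /=.
by case: asboolP => [//|[]]; exact: (dom_mono (modelP K) ww' ha).
Qed.

(** The valuation pushes negations inwards, so its clause for Not A corresponds to falsification of
    A, and neither half can be proved without the other. *)
Lemma val_satD (A : formula (diagram K)) (w : W) :
  (Defs.val A w <-> satD true A (@denot L K) w) /\
  (Defs.val (Not A) w <-> satD false A (@denot L K) w).
Proof.
have [n] := ubnP (fsize A); elim: n A w => // n IH A w; rewrite ltnS => hn.
have IHq x (B : formula (diagram K)) v a (ha : dom v a) : fsize B < n ->
    (Defs.val (subst (bar ha) x B) v <->
     satD true B (upd (@denot L K) (Var x) (fun=> Some a)) v) /\
    (Defs.val (Not (subst (bar ha) x B)) v <->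
     satD false B (upd (@denot L K) (Var x) (fun=> Some a)) v).
  move=> hB; have [H1 H2] := IH (subst (bar ha) x B) v ltac:(by rewrite fsize_subst).
  by split; [rewrite H1|rewrite H2]; exact: bar_sat.
case: A hn => [P ts|t|B|B C|B C|B C|x B|x B] /= hn //.
- have [IH1 IH2] := IH B w hn.
  by rewrite val_NotNot; split.
- have [B1 B2] := IH B w (leq_ltn_trans (leq_addr _ _) hn).
  have [C1 C2] := IH C w (leq_ltn_trans (leq_addl _ _) hn).
  by rewrite val_And val_NotAnd /satD /= -/(satD _ _ _ _) B1 B2 C1 C2.
- have [B1 B2] := IH B w (leq_ltn_trans (leq_addr _ _) hn).
  have [C1 C2] := IH C w (leq_ltn_trans (leq_addl _ _) hn).
  by rewrite val_Or val_NotOr B1 B2 C1 C2.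
- have hB v := IH B v (leq_ltn_trans (leq_addr _ _) hn).
  have hC v := IH C v (leq_ltn_trans (leq_addl _ _) hn).
  rewrite val_Imp val_NotImp (hB w).1 (hC w).2; split=> //.
  by split=> H v wv /(hB v).1 /(H v wv) /(hC v).1.
- rewrite val_All val_NotAll; split; split.
  + by move=> H v wv a ha; apply/(IHq x B v a ha hn).1; exact: H.
  + by move=> H v wv a ha; apply/(IHq x B v a ha hn).1; exact: H.
  + by move=> [a [ha H]]; exists a => //; apply/(IHq x B w a ha hn).2.
  + by move=> [a ha H]; exists a, ha; apply/(IHq x B w a ha hn).2.
- rewrite val_Ex val_NotEx; split; split.
  + by move=> [a [ha H]]; exists a => //; apply/(IHq x B w a ha hn).1.
  + by move=> [a ha H]; exists a, ha; apply/(IHq x B w a ha hn).1.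
  + by move=> H v wv a ha; apply/(IHq x B v a ha hn).2; exact: H.
  + by move=> H v wv a ha; apply/(IHq x B v a ha hn).2; exact: H.
Qed.

Definition term_val (t : term L) (w : W) : option (elem K) :=
  if t is Cst c then icst c w else None.

Lemma forces_satL (w : W) (A : formula L) :
  forces w A <-> satL true A term_val w.
Proof.
rewrite /forces (val_satD _ w).1 /satD sat_embed /satL.
suff -> : (fun t => @denot L K (embed_term K t)) = term_val by [].
by apply/funext => -[].
Qed.

(** What soundness needs of a valuation. Both conditions concern w and later stages, so a constant
    may be revalued to an element of the domain of w that is missing from earlier domains. *)
Definition admissible (r : term L -> W -> option (elem K)) (w : W) :=
  stable_above (@le L K) r w /\ (forall t a, r t w = Some a -> dom w a).

Lemma admissible_le r (w w' : W) : admissible r w -> le w w' -> admissible r w'.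
Proof.
move=> [h1 h2] ww'; split; first exact: stable_above_le ww'.
by move=> t a; rewrite h1 // => /h2; exact: (dom_mono (modelP K) ww').
Qed.

Lemma admissible_upd r (w : W) t a :
  admissible r w -> dom w a -> admissible (upd r t (fun=> Some a)) w.
Proof.
move=> [h1 h2] da; split; first exact: stable_above_upd.
by move=> u b; rewrite /upd; case: asboolP => [_ [<-]|_ /h2].
Qed.

Lemma term_val_admissible (w : W) : admissible term_val w.
Proof.
split=> [[x|c] w' ww' //=|[x|c] a //=]; first exact: (icst_stable (modelP K)).
exact: (icst_dom (modelP K)).
Qed.

Lemma extension_mono p (P : predE L) (w w' : W) : le w w' ->
  @extension L K p P w `<=` @extension L K p P w'.
Proof.
move=> ww' s; rewrite /extension.
have KP := modelP K.
case: p; case: P s => [P|] s /=; first exact: ppos_mono.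
- exact: ieqp_mono.
- exact: pneg_mono.
- exact: ieqn_mono.
Qed.

Lemma satL_mono p (A : formula L) r (w w' : W) :
  admissible r w -> le w w' -> satL p A r w -> satL p A r w'.
Proof.
move=> [h _]; apply: sat_mono => //.
- by move=> ? ?; exact: (dom_mono (modelP K)).
- by move=> ? ? ? ?; exact: extension_mono.
Qed.

End ModelSatisfaction.

(** * Validity of the rules *)

Section Soundness.
Variables (L : language) (K : model L).
Local Notation W := (world K).
Let KP : is_model K := modelP K.

(** Clause (b) for identity itself: (a, a) lies in i_+ and (a, b) in i_-, and the second arises from
    the first by putting b for a in the last place. *)
Lemma ieqn_sym (w : W) a b : ieqn w a b -> ieqn w b a.
Proof.
move=> h; have [da _] := ieqn_dom KP h.
have [] := @ieqn_intro _ _ KP None w [tuple a; a] [tuple a; b] a b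
  (ieqp_refl KP da) h => //.
split; first by exists ord_max.
by case=> -[|[|//]] hi; [left|right]; rewrite !(tnth_nth a).
Qed.

(** The congruence fields of [is_model] concern the letters of [pred L]; for i_- the property comes
    from clause (b), replacing a' by b in the last place of (a, a'). *)
Lemma ieqn_congrl (w : W) a a' b : ieqp w a a' -> ieqn w a b -> ieqn w a' b.
Proof.
move=> e h.
have [] := @ieqn_intro _ _ KP None w [tuple a; a'] [tuple a; b] a' b e h => //.
split; first by exists ord_max.
by case=> -[|[|//]] hi; [left|right]; rewrite !(tnth_nth a).
Qed.

Lemma extension_congr p (P : predE L) (w : W) s s' :
  (forall i, ieqp w (tnth s i) (tnth s' i)) ->
  extension p P w s -> extension p P w s'.
Proof.
rewrite /extension.
case: p; case: P s s' => [P|] s s' /= h; first exact: ieqp_ppos.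
- move=> e; apply: (ieqp_trans KP) (h ord_max); apply: (ieqp_trans KP) e.
  exact: (ieqp_sym KP).
- exact: ieqp_pneg.
- move=> e; apply: (ieqn_congrl (h ord0)); apply: ieqn_sym.
  by apply: (ieqn_congrl (h ord_max)); exact: ieqn_sym.
Qed.

Lemma upd_subst_term (r : term L -> W -> option (elem K)) x v t :
  upd r (Var x) v t = if is_var x t then v else r t.
Proof.
rewrite /upd; case: t => [y|c] /=; last by case: asboolP.
by case: asboolP => [[->]|ne]; [rewrite eqxx|case: eqP => // yx; rewrite yx in ne].
Qed.

Lemma sat_atom_congr p P (ts : (arityE P).-tuple (term L)) x r (w : W) a b :
  admissible r w -> ieqp w a b ->
  satL p (Atom ts) (upd r (Var x) (fun=> Some a)) w ->
  satL p (Atom ts) (upd r (Var x) (fun=> Some b)) w.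
Proof.
move=> hr e [s hs hp].
exists [tuple (if is_var x (tnth ts i) then b else tnth s i) | i < arityE P].
  move=> i; rewrite tnth_mktuple upd_subst_term.
  by have := hs i; rewrite upd_subst_term; case: ifP.
apply: extension_congr hp => i; rewrite tnth_mktuple.
have := hs i; rewrite upd_subst_term; case: ifP => [_ [<-] //|_ hi].
by apply: (ieqp_refl KP); case: hr => _; apply; exact: hi.
Qed.

(** The argument values for x := a and x := b agree off the places of x and are a and b on them,
    which is [replaced]; the free occurrence of x supplies the one place it demands. *)
Lemma sat_atom_neq P (ts : (arityE P).-tuple (term L)) x r (w : W) a b :
  has (is_var x) ts ->
  satL true (Atom ts) (upd r (Var x) (fun=> Some a)) w ->
  satL false (Atom ts) (upd r (Var x) (fun=> Some b)) w ->
  ieqn w a b.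
Proof.
move=> hx [s hs hp] [s' hs' hn].
suff h : replaced a b s s' by case: (ieqn_intro KP hp hn h).
split.
  have /has_tnthP[i hi] := hx.
  exists i; move: (hs i) (hs' i); rewrite !upd_subst_term hi.
  by move=> [->] [->].
move=> i; move: (hs i) (hs' i); rewrite !upd_subst_term; case: ifP => _.
  by move=> [->] [->]; right.
by move=> -> [->]; left.
Qed.

Lemma sat_atom_def p P (cs : (arityE P).-tuple (const L)) i r (w : W) :
  satL p (Atom (map_tuple Cst cs)) r w -> satL true (Def (Cst (tnth cs i))) r w.
Proof.
by move=> [s hs _]; exists (tnth s i); have := hs i; rewrite tnth_map.
Qed.

Lemma satL_fresh p (A : formula L) c r v (w : W) :
  ~ occurs c A -> satL p A (upd r (Cst c) v) w <-> satL p A r w.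
Proof.
move=> nc; apply: sat_ext => [| |t w' _]; [exact: le_refl|exact: le_trans|].
by rewrite /upd; case: asboolP => // ->.
Qed.

Lemma sat_eigen p (A : formula L) c x r (w : W) a :
  ~ occurs c A ->
  satL p (subst c x A) (upd r (Cst c) (fun=> Some a)) w <->
  satL p A (upd r (Var x) (fun=> Some a)) w.
Proof.
move=> nc; rewrite /satL sat_subst upd_eq updC //; exact: satL_fresh.
Qed.

Lemma sat_eigen_hyps H c r (w w' : W) a :
  admissible r w -> le w w' -> fresh_for c H ->
  (forall B, H B -> satL true B r w) ->
  forall B, H B -> satL true B (upd r (Cst c) (fun=> Some a)) w'.
Proof.
move=> hr ww' hc hH B hB; apply/satL_fresh; first exact: hc.
by apply: satL_mono (hH _ hB).
Qed.

Lemma sat_substS p (A : formula L) c x r (w : W) a :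
  admissible r w -> r (Cst c) w = Some a ->
  satL p (subst c x A) r w <-> satL p A (upd r (Var x) (fun=> Some a)) w.
Proof.
move=> [hr _] e; rewrite /satL sat_subst.
apply: sat_ext => [| |t w' ww' _]; [exact: le_refl|exact: le_trans|].
by rewrite /upd; case: asboolP => // _; rewrite hr.
Qed.

(** The valuation and the stage are quantified inside the induction: an eigenvariable rule applies
    its hypothesis to r with c revalued to an arbitrary element of the current domain. *)
Lemma soundness (H : set (formula L)) (A : formula L) : deduction H A ->
  forall r (w : W), admissible r w ->
  (forall B, H B -> satL true B r w) -> satL true A r w.
Proof.
have Il (H1 H2 : set (formula L)) r (w : W) :
    (forall B, (H1 `|` H2) B -> satL true B r w) ->
    forall B, H1 B -> satL true B r w by move=> h B ?; apply: h; left.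
have Ir (H1 H2 : set (formula L)) r (w : W) :
    (forall B, (H1 `|` H2) B -> satL true B r w) ->
    forall B, H2 B -> satL true B r w by move=> h B ?; apply: h; right.
have Id (H1 : set (formula L)) C r (w : W) : satL true C r w ->
    (forall B, (H1 `\` [set C]) B -> satL true B r w) ->
    forall B, H1 B -> satL true B r w.
  by move=> hC h B hB; have [->//|ne] := pselect (B = C); apply: h; split.
elim=> {H A}.
- by move=> A _ r w _; apply.
- move=> H1 H2 A B _ IH1 _ IH2 r w hr hH.
  by split; [apply: IH1 => //; exact: Il hH|apply: IH2 => //; exact: Ir hH].
- by move=> H A B _ IH r w hr hH; case: (IH r w hr hH).
- by move=> H A B _ IH r w hr hH; case: (IH r w hr hH).
- by move=> H A B _ _ IH r w hr hH; left; apply: IH.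
- by move=> H A B _ _ IH r w hr hH; right; apply: IH.
- move=> H H1 H2 A B C _ IH _ IH1 _ IH2 r w hr hH.
  case: (IH r w hr (Il _ _ _ _ (Il _ _ _ _ hH))) => h.
    by apply: IH1 => //; apply: Id h _; apply: Ir (Il _ _ _ _ hH).
  by apply: IH2 => //; apply: Id h _; apply: Ir hH.
- by move=> H A B _ _ IH r w hr hH; left; apply: IH.
- by move=> H A B _ _ IH r w hr hH; right; apply: IH.
- move=> H H1 H2 A B C _ IH _ IH1 _ IH2 r w hr hH.
  case: (IH r w hr (Il _ _ _ _ (Il _ _ _ _ hH))) => h.
    by apply: IH1 => //; apply: (Id _ (Not A)) h _; apply: Ir (Il _ _ _ _ hH).
  by apply: IH2 => //; apply: (Id _ (Not B)) h _; apply: Ir hH.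
- move=> H1 H2 A B _ IH1 _ IH2 r w hr hH.
  by split; [apply: IH1 => //; exact: Il hH|apply: IH2 => //; exact: Ir hH].
- by move=> H A B _ IH r w hr hH; case: (IH r w hr hH).
- by move=> H A B _ IH r w hr hH; case: (IH r w hr hH).
- by move=> H A _ IH r w hr hH; apply: IH.
- by move=> H A _ IH r w hr hH; apply: IH.
- by move=> H P cs i _ IH r w hr hH; apply: sat_atom_def (IH r w hr hH).
- by move=> H P cs i _ IH r w hr hH; apply: (@sat_atom_def false) (IH r w hr hH).
- move=> H1 H2 c B _ _ IH1 _ IH2 r w hr hH.
  have [a] := IH1 r w hr (Il _ _ _ _ hH).
  by have /= -> := IH2 r w hr (Ir _ _ _ _ hH).
- move=> c r w _ _ /=; rewrite /satL /=.
  by case: (r (Cst c) w) => [a|]; [left; exists a|right].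
- move=> H c x A _ IH nc hc r w hr hH /= w' ww' a da.
  (* The premise is used at the later stage w' with c valued as a. This verifies Dc, and the other
     hypotheses persist to w' and do not contain c. *)
  apply/(sat_eigen true x r w' a nc); apply: IH.
    by apply: admissible_upd da; exact: admissible_le ww'.
  apply: (Id _ (Def (Cst c))); first by exists a; rewrite upd_eq.
  exact: sat_eigen_hyps hr ww' hc hH.
- move=> H1 H2 c x A _ IH1 _ IH2 r w hr hH.
  have [a ha] := IH2 r w hr (Ir _ _ _ _ hH).
  apply/(sat_substS true A x hr ha); apply: (IH1 r w hr (Il _ _ _ _ hH)) => //.
    exact: le_refl.
  by case: hr => _; apply; exact: ha.
- move=> H1 H2 c x A _ IH1 _ IH2 r w hr hH.
  have [a ha] := IH2 r w hr (Ir _ _ _ _ hH).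
  exists a; first by case: hr => _; apply; exact: ha.
  by apply/(sat_substS true A x hr ha); apply: IH1 => //; exact: Il hH.
- move=> H1 H2 c x A B _ IH1 _ IH2 ncA ncB hc r w hr hH.
  have [a da h] := IH1 r w hr (Il _ _ _ _ hH).
  apply/(satL_fresh true r (fun=> Some a) w ncB); apply: IH2.
    exact: admissible_upd da.
  apply: (Id _ (subst c x A)); first exact/sat_eigen.
  apply: (Id _ (Def (Cst c))); first by exists a; rewrite upd_eq.
  by apply: sat_eigen_hyps hr _ hc (Ir _ _ _ _ hH); exact: le_refl.
- move=> H1 H2 c x A _ IH1 _ IH2 r w hr hH.
  have [a ha] := IH2 r w hr (Ir _ _ _ _ hH).
  exists a; first by case: hr => _; apply; exact: ha.
  by apply/(sat_substS false A x hr ha); apply: IH1 => //; exact: Il hH.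
- move=> H1 H2 c x A B _ IH1 _ IH2 ncA ncB hc r w hr hH.
  have [a da h] := IH1 r w hr (Il _ _ _ _ hH).
  apply/(satL_fresh true r (fun=> Some a) w ncB); apply: IH2.
    exact: admissible_upd da.
  apply: (Id _ (Not (subst c x A))); first exact/(@sat_eigen false).
  apply: (Id _ (Def (Cst c))); first by exists a; rewrite upd_eq.
  by apply: sat_eigen_hyps hr _ hc (Ir _ _ _ _ hH); exact: le_refl.
- move=> H c x A _ IH nc hc r w hr hH /= w' ww' a da.
  apply/(sat_eigen false x r w' a nc); apply: IH.
    by apply: admissible_upd da; exact: admissible_le ww'.
  apply: (Id _ (Def (Cst c))); first by exists a; rewrite upd_eq.
  exact: sat_eigen_hyps hr ww' hc hH.
- move=> H1 H2 c x A _ IH1 _ IH2 r w hr hH.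
  have [a ha] := IH2 r w hr (Ir _ _ _ _ hH).
  apply/(sat_substS false A x hr ha); apply: (IH1 r w hr (Il _ _ _ _ hH)) => //.
    exact: le_refl.
  by case: hr => _; apply; exact: ha.
- move=> H c _ IH r w hr hH; have [a ha] := IH r w hr hH.
  exists [tuple a; a].
    by case=> -[|[|//]] hi; rewrite !(tnth_nth (Cst c)) (tnth_nth a).
  by apply: (ieqp_refl KP); case: hr => _; apply; exact: ha.
- move=> H1 H2 c1 c2 x A hA _ IH1 _ IH2 r w hr hH.
  have [s hs e] := IH2 r w hr (Ir _ _ _ _ hH).
  have ha := hs ord0; have hb := hs ord_max.
  apply/(sat_substS true A x hr hb).
  have /(sat_substS true A x hr ha) := IH1 r w hr (Il _ _ _ _ hH).
  case: hA => [|[B +] ->] => -[[P [ts ->]]|[t ->]].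
  + exact: sat_atom_congr.
  (* For Dx the identity premise gives c2 a value; for ~Dx, two cases below, the premise contradicts
     the value of c1. *)
  + by rewrite /satL /= !upd_subst_term; case: ifP => // _ _; exists (tnth s ord_max).
  + exact: (@sat_atom_congr false).
  + by rewrite /satL /= !upd_subst_term; case: ifP.
- move=> H1 H2 c1 c2 x A [P [ts ->]] hx _ IH1 _ IH2 r w hr hH.
  have h1 := IH1 r w hr (Il _ _ _ _ hH); have h2 := IH2 r w hr (Ir _ _ _ _ hH).
  have /has_tnthP[i hi] := hx.
  have [a ha] : exists a, r (Cst c1) w = Some a.
    by case: h1 => s /(_ i); rewrite tnth_map /subst_term hi; exists (tnth s i).
  have [b hb] : exists b, r (Cst c2) w = Some b.
    by case: h2 => s /(_ i); rewrite tnth_map /subst_term hi; exists (tnth s i).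
  exists [tuple a; b].
    by case=> -[|[|//]] k; rewrite !(tnth_nth (Cst c1)) (tnth_nth a).
  apply: sat_atom_neq hx _ _; first exact/(sat_substS true (Atom ts) x hr ha).
  exact/(sat_substS false (Atom ts) x hr hb).
- move=> H A B _ _ IH r w hr hH /= w' ww' hA.
  apply: (IH r w' (admissible_le hr ww')); apply: Id hA _ => C hC.
  exact: satL_mono hr ww' (hH _ hC).
- move=> H1 H2 A B _ IH1 _ IH2 r w hr hH.
  apply: (IH1 r w hr (Il _ _ _ _ hH)); first exact: le_refl.
  by apply: IH2 => //; exact: Ir hH.
- move=> H1 H2 A B _ IH1 _ IH2 r w hr hH.
  by split; [apply: IH1 => //; exact: Il hH|apply: IH2 => //; exact: Ir hH].
- by move=> H A B _ IH r w hr hH; case: (IH r w hr hH).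
- by move=> H A B _ IH r w hr hH; case: (IH r w hr hH).
Qed.

End Soundness.

Lemma provable_entails (L : language) (G : set (formula L)) (A : formula L) :
  provable G A -> entails G A.
Proof.
move=> [H HG dA] K w hG; apply/forces_satL; apply: (soundness dA).
  exact: term_val_admissible.
by move=> B /HG /hG /forces_satL.
Qed.

(** * Prime theories *)

Definition lang (M : language) (X : set (formula M)) (c : const M) : Prop :=
  exists2 B, X B & occurs c B.

(** Closure is restricted to the constants occurring in X, so that all others remain fresh.
    Witnesses are demanded for [Ex] only; those for ~All follow in [theory_NotAll]. *)
Record saturated (M : language) (X : set (formula M)) : Prop := Saturated {
  saturated_sentence : forall B, X B -> sentence B;
  saturated_closed : forall B, provable X B ->
    (forall c, occurs c B -> lang X c) -> X B;
  saturated_prime : forall B C, X (Or B C) -> X B \/ X C;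
  saturated_witness : forall x B, X (Ex x B) ->
    exists c, X (subst c x B) /\ X (Def (Cst c)) }.

Lemma occurs_subst (M : language) (c d : const M) x A :
  occurs d (subst c x A) -> d = c \/ occurs d A.
Proof.
have Ht (t : term M) : subst_term c x t = Cst d -> d = c \/ t = Cst d.
  by rewrite /subst_term; case: ifP => _; [move=> [->]; left|right].
elim: A => //= [P ts|B IHB D IHD|B IHB D IHD|B IHB D IHD|y B IH|y B IH].
- by move=> [i]; rewrite tnth_map => /Ht[->|hi]; [left|right; exists i].
- by move=> [/IHB|/IHD] [->|h]; [left|right; left|left|right; right].
- by move=> [/IHB|/IHD] [->|h]; [left|right; left|left|right; right].
- by move=> [/IHB|/IHD] [->|h]; [left|right; left|left|right; right].
- by case: eqP => _ // h; right.
- by case: eqP => _ // h; right.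
Qed.

(** * Maximal theories by Zorn's lemma *)

Section Lindenbaum.
Variables (M : language) (old : set (const M)) (wit : formula M -> const M).
Hypothesis wit_inj : injective wit.
Hypothesis wit_new : forall B, ~ old (wit B).
Variables (T : set (formula M)) (A : formula M).
Hypothesis T_sentence : forall B, T B -> sentence B.
Hypothesis T_old : lang T `<=` old.
Hypothesis A_old : forall c, occurs c A -> old c.
Hypothesis T_unprovable : ~ provable T A.

(* A witness constant may occur only if its existential formula has been
   instantiated with it; hence a witness that does not occur is an admissible
   eigenvariable, and no theory needs to be closed under witnesses in advance. *)
Definition orderly (X : set (formula M)) := forall c, lang X c ->
  old c \/ exists x B, [/\ c = wit (Ex x B), X (subst c x B) & X (Def (Cst c))].

Definition good (X : set (formula M)) :=
  [/\ T `<=` X, forall B, X B -> sentence B, orderly X & ~ provable X A].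

Lemma lang_setU (X Y : set (formula M)) c :
  lang (X `|` Y) c -> lang X c \/ lang Y c.
Proof. by move=> [B [hB|hB] hc]; [left|right]; exists B. Qed.

Lemma chain_bound (F : set (set (formula M))) (l : seq (formula M)) :
  total_on F subset -> (exists X, F X) ->
  (forall B, List.In B l -> (T `|` \bigcup_(X in F) X) B) ->
  exists2 X, F X & forall B, List.In B l -> (T `|` X) B.
Proof.
move=> tot [X0 FX0]; elim: l => [|B l IH] h; first by exists X0.
have [X FX hX] := IH (fun B hB => h B (or_intror hB)).
case: (h B (or_introl erefl)) => [TB|[Y FY YB]].
  by exists X => // D [<-|/hX //]; left.
case: (tot X Y FX FY) => XY.
  by exists Y => // D [<-|/hX [?|/XY ?]]; [right|left|right].
by exists X => // D [<-|/hX //]; right; exact: XY.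
Qed.

(** Zorn's lemma is applied to the sets S for which T together with S is good: the empty chain then
    has the bound T, where the assumptions on T apply. *)
Lemma good_chain (F : set (set (formula M))) :
  F `<=` (fun S => good (T `|` S)) -> total_on F subset ->
  good (T `|` \bigcup_(X in F) X).
Proof.
move=> FG tot; split; first by move=> B; left.
- by move=> B [/T_sentence //|[X /FG[_ + _ _] XB]]; apply; right.
- move=> c /lang_setU[/T_old|[B [X FX XB] hc]]; first by left.
  have [_ _ + _] := FG X FX => /(_ c) []; [by exists B => //; right|by left|].
  move=> [x [D [-> h1 h2]]]; right; exists x, D; split=> //.
    by case: h1 => ?; [left|right; exists X].
  by case: h2 => ?; [left|right; exists X].
- move=> [H HF dA]; have [X0|nF] := pselect (exists X, F X); last first.
    apply: T_unprovable; exists H => // B /HF[//|[X FX _]].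
    by case: nF; exists X.
  have [l hl] := deduction_finite dA.
  (* [deduction_finite] gives a list that covers H but may exceed it; [chain_bound] needs every
     entry to lie in the union. *)
  pose l' := [seq B <- l | `[< H B >]].
  have hl' B : List.In B l' <-> H B.
    rewrite /l'; split.
      elim: (l) => //= D l0 IH; case: asboolP => // hD [<-//|]; exact: IH.
    move=> hB; have := hl B hB; elim: (l) => //= D l0 IH.
    by case: asboolP => hD [DB|/IH ?]; [left|right|rewrite DB in hD|].
  have [X FX hX] := @chain_bound F l' tot X0 (fun B h => HF B ((hl' B).1 h)).
  have [_ _ _] := FG X FX; apply; exists H => // B hB; apply: hX; exact/hl'.
Qed.

Lemma good_maximal : exists2 X, good X & forall Y, X `<=` Y -> good Y -> Y `<=` X.
Proof.
have [S [gS maxS]] := Zorn_bigcup good_chain.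
exists (T `|` S) => // Y XY gY; apply: contrapT => nY.
apply: (maxS Y); last by rewrite (_ : T `|` Y = Y) //; apply/setUidPr; case: gY.
split; first by move=> B hB; apply: XY; right.
by move=> YS; apply: nY => B /YS; right.
Qed.

Lemma lindenbaum : exists X, [/\ T `<=` X, saturated X, old `<=` lang X,
  lang X `<=` old `|` range wit & ~ provable X A].
Proof.
have [X [TX sX oX nX] maxX] := good_maximal.
have prX B : X B -> provable X B by move=> hB; apply: provable_hyp => //; exact: sX.
(* Maximality in usable form: a sentence whose constants are old or already present belongs to X
   unless adding it makes A provable. *)
have add B : sentence B -> (forall c, occurs c B -> old c \/ lang X c) ->
    ~ provable (B |` X) A -> X B.
  move=> sB hB nB; apply: (maxX (B |` X)); [by right| |by left].
  split=> //; first by move=> D /TX; right.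
  - by move=> D [->|/sX].
  - move=> c /lang_setU[[_ -> /hB[|/oX[|]]]|/oX[|]]; try by left.
      by move=> [x [D [e h1 h2]]]; right; exists x, D; split=> //; right.
    by move=> [x [D [e h1 h2]]]; right; exists x, D; split=> //; right.
have closed B : provable X B -> (forall c, occurs c B -> old c \/ lang X c) -> X B.
  move=> pB hB; apply: add => //; first exact: provable_sentence pB.
  by move=> /(provable_cut pB).
(* The PEM instance for an old constant is a theorem, so closure puts it into X and the constant
   occurs there. *)
have old_lang : old `<=` lang X.
  move=> c hc; exists (Or (Def (Cst c)) (Not (Def (Cst c)))); last by left.
  apply: closed; first by exists set0 => //; exact: d_pemD.
  by move=> d /= [[<-]|[<-]]; left.
exists X; split=> //; last first.
  move=> c /oX[|[x [B [-> _ _]]]]; [by left|by right; exists (Ex x B)].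
split=> //.
- by move=> B pB hB; apply: closed => // c /hB; right.
- move=> B C hBC; apply: contrapT => /not_orP [nB nC]; apply: nX.
  have sBC := sX _ hBC.
  have [sB sC] : sentence B /\ sentence C.
    by split=> x; have /norP[] := sBC x.
  apply: (provable_orE (prX _ hBC)); apply: contrapT => h.
    apply: nB; apply: add => // c hc; right.
    by exists (Or B C) => //; left.
  apply: nC; apply: add => // c hc; right.
  by exists (Or B C) => //; right.
- move=> x B hB; exists (wit (Ex x B)).
  (* If the witness already occurs, [orderly] and the injectivity of [wit] show that it was
     introduced for this very formula. If not, its instance and its definedness can be added, and
     maximality returns both. *)
  have [|nc] := pselect (lang X (wit (Ex x B))).
    by move=> /oX[/wit_new//|[y [D [/wit_inj[<- <-] h1 h2]]]].
  set c := wit (Ex x B) in nc *.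
  set Y := subst c x B |` (Def (Cst c) |` X).
  suff YX : Y `<=` X by split; apply: YX; [left|right; left].
  apply: maxX; first by move=> D; right; right.
  have sB : sentence (subst c x B).
    apply: subst_sentence => y yx; have := sX _ hB y => /=.
    by rewrite eq_sym yx.
  have up D : X D -> Y D by right; right.
  split.
  + by move=> D /TX /up.
  + by move=> D [->//|[-> //|/sX]].
  + have new : exists y D, [/\ c = wit (Ex y D), Y (subst c y D) & Y (Def (Cst c))].
      by exists x, B; split=> //; [left|right; left].
    have oldX d : lang X d -> old d \/ exists y D,
        [/\ d = wit (Ex y D), Y (subst d y D) & Y (Def (Cst d))].
      move=> /oX[|[y [D [e h1 h2]]]]; first by left.
      by right; exists y, D; split=> //; exact: up.
    move=> d /lang_setU[[_ -> /occurs_subst[->|hd]]|/lang_setU[[_ -> [<-]]|]].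
    * by right.
    * by apply: oldX; exists (Ex x B).
    * by right.
    * exact: oldX.
  + move=> pY; apply: nX; apply: (provable_exE _ _ _ (prX _ hB) pY).
    * by move=> hc; apply: nc; exists (Ex x B).
    * by move=> /A_old /wit_new.
    * by move=> D hD hc; apply: nc; exists D.
Qed.

End Lindenbaum.

(** * The language of trees *)

Section Codes.
Variables (Pr : Type) (ar : Pr -> nat) (C : Type).
Hypothesis hC : infinite_set [set: C].

(** [CPred] lets formulas over an arbitrary type of predicate letters be encoded. The labels of
    [CNode] serve both as tags of the encoding and as indices of witnesses; [encode] only has to be
    injective. *)
Inductive code := CBase (c : C) | CPred (P : Pr) | CNode (n : nat) (l : seq code).

Lemma code_infinite : infinite_set [set: code].
Proof.
move=> fin; apply: hC.
rewrite -(preimage_setT CBase); apply: finite_preimage => // x y _ _ [].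
by [].
Qed.

Definition code_language : language := @Language code Pr ar code_infinite.
Local Notation L' := code_language.

Definition encode_nat (n : nat) : code := CNode n [::].

Definition encode_pred (P : predE L') : code :=
  if P is Some Q then CPred Q else CNode 0 [::].

Definition encode_term (t : term L') : code :=
  match t with Var x => CNode 0 [:: encode_nat x] | Cst c => CNode 1 [:: c] end.

Fixpoint encode (A : formula L') : code :=
  match A with
  | Atom P ts => CNode 0 (encode_pred P :: map encode_term ts)
  | Def t => CNode 1 [:: encode_term t]
  | Not B => CNode 2 [:: encode B]
  | And B D => CNode 3 [:: encode B; encode D]
  | Or B D => CNode 4 [:: encode B; encode D]
  | Imp B D => CNode 5 [:: encode B; encode D]
  | All x B => CNode 6 [:: encode_nat x; encode B]
  | Ex x B => CNode 7 [:: encode_nat x; encode B]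
  end.

Lemma encode_term_inj : injective encode_term.
Proof. by move=> [x|c] [y|d] // [->]. Qed.

Lemma encode_inj : injective encode.
Proof.
elim=> [P ts|t|B IH|B IHB D IHD|B IHB D IHD|B IHB D IHD|x B IH|x B IH]
  [P' ts'|t'|B'|B' D'|B' D'|B' D'|x' B'|x' B'] //=.
- move=> [EP /(inj_map encode_term_inj) /= Ets].
  have EP' : P = P' by case: P P' EP {ts ts' Ets} => [Q|] [Q'|] //= [->].
  by case: _ / EP' ts' Ets => ts' Ets; congr Atom; exact: val_inj.
- by move=> [/encode_term_inj ->].
- by move=> [/IH ->].
- by move=> [/IHB -> /IHD ->].
- by move=> [/IHB -> /IHD ->].
- by move=> [/IHB -> /IHD ->].
- by move=> [-> /IH ->].
- by move=> [-> /IH ->].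
Qed.

(** The root alone counts: [witness k A] has level k + 1 whatever constants A contains. A single
    level therefore witnesses existential formulas about its own constants, and the bound of a
    theory rises only once. *)
Definition level (c : code) : nat := if c is CNode k _ then k.+1 else 0.

Definition witness (k : nat) (A : formula L') : const L' := CNode k [:: encode A].

Lemma witness_inj k : injective (witness k).
Proof. by move=> A B [/encode_inj]. Qed.

Local Notation L := (@Language C Pr ar hC).

Definition base_lang : formula L -> formula L' := fmap CBase.

(** [theory_base] makes every theory decide the definedness of each constant of L; with consistency
    this fixes the interpretation of that constant along inclusion. *)
Record theory (X : set (formula L')) : Prop := Theory {
  theory_saturated : saturated X;
  theory_consistent : exists2 B, sentence B & ~ provable X B;
  theory_level : exists k, forall c, lang X c -> level c <= k;
  theory_base : forall c : C, lang X (CBase c) }.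

Lemma theory_extension k (T : set (formula L')) (A : formula L') :
  (forall B, T B -> sentence B) -> sentence A ->
  (forall c, lang T c -> level c <= k) ->
  (forall c, occurs c A -> level c <= k) -> ~ provable T A ->
  exists X, [/\ theory X, T `<=` X & ~ provable X A].
Proof.
move=> sT sA lT lA nT.
have new B : ~ [set c : code | level c <= k] (witness k B) by rewrite /= ltnn.
have [X [TX sX oX lX nX]] := @lindenbaum L' [set c | level c <= k] _
  (@witness_inj k) new T A sT lT lA nT.
exists X; split=> //; split=> //.
- by exists A.
- by exists k.+1 => c /lX[/= h|[B _ <-] //]; exact: leqW.
- by move=> c; exact: oX.
Qed.

End Codes.
Arguments base_lang {Pr ar C hC} _.

(** * The canonical model *)

Section CanonicalModel.
Variables (Pr : Type) (ar : Pr -> nat) (C : Type).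
Variable hC : infinite_set [set: C].
Local Notation L := (@Language C Pr ar hC).
Local Notation L' := (code_language ar hC).
Implicit Types (X : set (formula L')) (A B : formula L') (c d : const L').

Section Theory.
Variable X : set (formula L').
Hypothesis thX : theory X.
Let satX := theory_saturated thX.

Lemma theory_provable B : X B -> provable X B.
Proof.
by move=> hB; apply: provable_hyp => //; exact: saturated_sentence satX _ hB.
Qed.

Lemma theory_rule1 A B : (forall H, deduction H A -> deduction H B) ->
  (forall c, occurs c B -> lang X c) -> X A -> X B.
Proof.
move=> h hB /theory_provable hA; apply: (saturated_closed satX) hB.
exact: provable1 hA.
Qed.

Lemma theory_rule2 A B D :
  (forall H1 H2, deduction H1 A -> deduction H2 B -> deduction (H1 `|` H2) D) ->
  (forall c, occurs c D -> lang X c) -> X A -> X B -> X D.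
Proof.
move=> h hD /theory_provable hA /theory_provable hB.
by apply: (saturated_closed satX) hD; exact: provable2 hA hB.
Qed.

Lemma lang_Def c : X (Def (Cst c)) -> lang X c.
Proof. by move=> h; exists (Def (Cst c)). Qed.

Lemma theory_pem c : lang X c -> X (Def (Cst c)) \/ X (Not (Def (Cst c))).
Proof.
move=> hc; apply: (saturated_prime satX); apply: (saturated_closed satX).
  by exists set0 => //; exact: d_pemD.
by move=> d /= [[<-]|[<-]].
Qed.

Lemma theory_pex c : X (Def (Cst c)) -> ~ X (Not (Def (Cst c))).
Proof.
move=> /theory_provable h1 /theory_provable h2.
have [B sB] := theory_consistent thX; apply.
by apply: provable2 h1 h2 => H1 H2; exact: d_pexD.
Qed.

Lemma theory_def (P : predE L') (cs : (arityE P).-tuple (const L')) i :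
  X (Atom (map_tuple (@Cst L') cs)) -> X (Def (@Cst L' (tnth cs i))).
Proof.
move=> h; apply: theory_rule1 (h) => [H|c /= [<-]].
  exact: (@d_defI L' H P cs i).
by exists (Atom (map_tuple (@Cst L') cs)) => //; exists i; rewrite tnth_map.
Qed.

Lemma theory_defN (P : predE L') (cs : (arityE P).-tuple (const L')) i :
  X (Not (Atom (map_tuple (@Cst L') cs))) -> X (Def (@Cst L' (tnth cs i))).
Proof.
move=> h; apply: theory_rule1 (h) => [H|c /= [<-]].
  exact: (@d_defNI L' H P cs i).
by exists (Not (Atom (map_tuple (@Cst L') cs))) => //; exists i; rewrite tnth_map.
Qed.

Definition signed (p : bool) (A : formula L') := if p then A else Not A.

Lemma occurs_signed p A c : occurs c (signed p A) = occurs c A.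
Proof. by case: p. Qed.

Lemma theory_eqE p (P : predE L') (ts : (arityE P).-tuple (term L')) x c d :
  X (Eqn (Cst c) (Cst d)) -> X (signed p (subst c x (Atom ts))) ->
  X (signed p (subst d x (Atom ts))).
Proof.
move=> hE hA; have sub e : signed p (subst e x (Atom ts)) = subst e x (signed p (Atom ts)).
  by case: (p).
rewrite sub.
apply: theory_rule2 (hA) (hE) => [H1 H2|e].
  rewrite sub.
  have aT : atomic (Atom ts) by left; exists P, ts.
  by apply: d_eqE; case: (p); [left|right; exists (Atom ts)].
rewrite -sub occurs_signed /= => -[i]; rewrite tnth_map /subst_term.
case: ifP => [_ [<-]|hi hc].
  by exists (Eqn (Cst c) (Cst d)) => //=; exists ord_max.
exists (signed p (subst c x (Atom ts))) => //; rewrite occurs_signed /=.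
by exists i; rewrite tnth_map /subst_term hi.
Qed.

(* Leibniz's law for one argument place at a time, by d_eqE with a variable
   in that place. *)
Lemma theory_congr p (P : predE L') (s s' : (arityE P).-tuple (const L')) :
  (forall i, X (Eqn (@Cst L' (tnth s i)) (@Cst L' (tnth s' i)))) ->
  X (signed p (Atom (map_tuple (@Cst L') s))) ->
  X (signed p (Atom (map_tuple (@Cst L') s'))).
Proof.
move=> he h0.
pose mix n : (arityE P).-tuple (const L') :=
  [tuple (if i < n then tnth s' i else tnth s i) | i < arityE P].
suff h n : n <= arityE P -> X (signed p (Atom (map_tuple (@Cst L') (mix n)))).
  have <- : mix (arityE P) = s'.
    by apply: eq_from_tnth => i; rewrite tnth_mktuple ltn_ord.
  exact: h.
elim: n => [|n IH] hn.
  suff -> : mix 0 = s by [].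
  by apply: eq_from_tnth => i; rewrite tnth_mktuple.
pose k := Ordinal hn.
pose ts : (arityE P).-tuple (term L') :=
  [tuple (if i == k then @Var L' 0 else @Cst L' (tnth (mix n) i)) | i < arityE P].
have sub (c : const L') m : tnth (mix m) k = c ->
    (forall i, i != k -> tnth (mix m) i = tnth (mix n) i) ->
    Atom (map_tuple (@Cst L') (mix m)) = subst c 0 (Atom ts).
  move=> hk hi; congr Atom; apply: eq_from_tnth => i.
  rewrite [LHS]tnth_map [RHS]tnth_map [tnth ts i]tnth_mktuple.
  case: eqP => [->|/eqP ik]; first by rewrite hk.
  by rewrite -hi.
rewrite (sub (tnth s' k : const L')).
- apply: theory_eqE (he k) _; rewrite -(sub _ n) //; first exact: IH (ltnW hn).
  by rewrite tnth_mktuple ltnn.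
- by rewrite tnth_mktuple leqnn.
- move=> i ik; rewrite !tnth_mktuple ltnS leq_eqVlt.
  by case: eqP => // e; case/negP: ik; apply/eqP/val_inj.
Qed.

(** One use of [d_neqI] covers replacement at several places: the variable stands exactly where s
    has a and s' has a', and elsewhere the tuples agree. *)
Lemma theory_replaced (P : predE L') (s s' : (arityE P).-tuple (const L')) a a' :
  X (Atom (map_tuple (@Cst L') s)) ->
  X (Not (Atom (map_tuple (@Cst L') s'))) -> replaced a a' s s' ->
  X (Not (Eqn (@Cst L' a) (@Cst L' a'))).
Proof.
move=> hs hs' [[i [ia ia']] h].
pose ts : (arityE P).-tuple (term L') :=
  [tuple (if `[< tnth s i = a /\ tnth s' i = a' >] then @Var L' 0
          else @Cst L' (tnth s i)) | i < arityE P].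
have Es : Atom (map_tuple (@Cst L') s) = subst (a : const L') 0 (Atom ts).
  congr Atom; apply: eq_from_tnth => j; rewrite !tnth_map tnth_ord_tuple.
  by case: asboolP => [[<- _]|].
have Es' : Atom (map_tuple (@Cst L') s') = subst (a' : const L') 0 (Atom ts).
  congr Atom; apply: eq_from_tnth => j; rewrite !tnth_map tnth_ord_tuple.
  by case: asboolP => [[_ <-]|nj] //; case: (h j) => [->|].
(* Definedness shows that a and a' occur in X, as relative closure requires of the conclusion. *)
have d1 := theory_def i hs; have d2 := theory_defN i hs'.
rewrite ia in d1; rewrite ia' in d2.
rewrite Es in hs; rewrite Es' in hs'.
apply: theory_rule2 (hs) (hs') => [H1 H2|c /= [j]]; last first.
  by case: j => -[|[|//]] hj [<-]; apply: lang_Def.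
apply: d_neqI; first by exists P, ts.
apply/has_tnthP; exists i; rewrite tnth_mktuple.
by case: asboolP => // -[].
Qed.

End Theory.
End CanonicalModel.


Lemma map_pair (T U : Type) (f : T -> U) (u : 2.-tuple T) :
  map_tuple f u = [tuple f (tnth u ord0); f (tnth u ord_max)].
Proof. by apply: val_inj; case: u => -[|a [|b [|? ?]]]. Qed.

Lemma occurs_Eqn (M : language) (a b d : const M) :
  occurs d (Eqn (Cst a) (Cst b)) -> d = a \/ d = b.
Proof. by case=> -[[|[|//]] hi] [<-]; [left|right]. Qed.

(** * Theories as stages *)

Section Canonical.
Variables (Pr : Type) (ar : Pr -> nat) (C : Type).
Variable hC : infinite_set [set: C].
Local Notation L := (@Language C Pr ar hC).
Local Notation L' := (code_language ar hC).
Implicit Types (A B : formula L') (c d : const L').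

Definition theories := {X : set (formula L') | theory X}.
Implicit Types (w : theories).

(** The elements are the constants themselves: i_+ is an equivalence relation rather than equality,
    so no quotient is taken. A constant of L denotes its own copy wherever that copy is defined. *)
Definition canonical_structure : structure L :=
  @Structure L theories (fun w w' => sval w `<=` sval w') (const L')
    (fun w => [set c | sval w (Def (Cst c))])
    (fun (e : const L) w => let b : const L' := CBase Pr e in
      if `[< sval w (Def (Cst b)) >] then Some b else None)
    (fun P w s => sval w (@Atom L' (Some P) (map_tuple (@Cst L') s)))
    (fun P w s => sval w (Not (@Atom L' (Some P) (map_tuple (@Cst L') s))))
    (fun w a b => sval w (Eqn (Cst a) (Cst b)))
    (fun w a b => sval w (Not (Eqn (Cst a) (Cst b)))).

Lemma canonical_extension p (P : predE L') w (s : (arityE P).-tuple (const L')) :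
  @extension L canonical_structure p P w s =
  sval w (signed p (Atom (map_tuple (@Cst L') s))).
Proof.
by case: P s => [P|] s; case: p => //=; rewrite /extension /= /Eqn (map_pair _ s).
Qed.

Lemma Eqn_tuple (a b : const L') :
  Eqn (Cst a) (Cst b) = @Atom L' None (map_tuple (@Cst L') [tuple a; b]).
Proof. by congr Atom; rewrite map_pair. Qed.

Lemma theory_eq_refl w c : sval w (Def (Cst c)) -> sval w (Eqn (Cst c) (Cst c)).
Proof.
have thw := svalP w => h; apply: (theory_rule1 thw) (h) => [H|d]; first exact: d_eqI.
by move=> /occurs_Eqn[->|->]; exact: lang_Def.
Qed.

Lemma theory_def2 w c d : sval w (Eqn (Cst c) (Cst d)) ->
  sval w (Def (Cst c)) /\ sval w (Def (Cst d)).
Proof.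
rewrite Eqn_tuple => h.
have hd := @theory_def _ _ _ _ _ (svalP w) None [tuple c; d] _ h.
by split; [exact: hd ord0|exact: hd ord_max].
Qed.

Lemma theory_defN2 w c d : sval w (Not (Eqn (Cst c) (Cst d))) ->
  sval w (Def (Cst c)) /\ sval w (Def (Cst d)).
Proof.
rewrite Eqn_tuple => h.
have hd := @theory_defN _ _ _ _ _ (svalP w) None [tuple c; d] _ h.
by split; [exact: hd ord0|exact: hd ord_max].
Qed.

Lemma theory_eq_sym w c d :
  sval w (Eqn (Cst c) (Cst d)) -> sval w (Eqn (Cst d) (Cst c)).
Proof.
move=> h; have [dc _] := theory_def2 h.
have := @theory_eqE _ _ _ _ _ (svalP w) true None [tuple Var 0; Cst c] 0 c d h.
by rewrite /= !map_pair; apply; exact: theory_eq_refl.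
Qed.

Lemma theory_eq_trans w c d e : sval w (Eqn (Cst c) (Cst d)) ->
  sval w (Eqn (Cst d) (Cst e)) -> sval w (Eqn (Cst c) (Cst e)).
Proof.
move=> h1 h2.
have := @theory_eqE _ _ _ _ _ (svalP w) true None [tuple Cst c; Var 0] 0 d e h2.
by rewrite /= !map_pair; apply.
Qed.

(** The rule for inequality applied to d = d and ~(c = d), with the variable in the first place. *)
Lemma theory_neq_sym w c d :
  sval w (Not (Eqn (Cst c) (Cst d))) -> sval w (Not (Eqn (Cst d) (Cst c))).
Proof.
move=> h; have [_ dd] := theory_defN2 h.
have e := theory_eq_refl dd.
rewrite Eqn_tuple in h; rewrite Eqn_tuple in e.
apply: (theory_replaced (svalP w) e h).
split; first by exists ord0.
by case=> -[|[|//]] hi; [right|left].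
Qed.

Lemma canonical_is_model : inhabited theories -> is_model canonical_structure.
Proof.
move=> [w0].
have th (w : theories) : theory (sval w) := svalP w.
split => //=.
- by move=> w B.
- by move=> u v w uv vw; exact: subset_trans vw.
- by move=> w w' ww' c; exact: ww'.
- by move=> c w a; case: asboolP => // h [<-].
- move=> c w w' ww'; case: asboolP => h'; case: asboolP => // h; last first.
    by case: h'; exact: ww'.
  (* A constant undefined at w has ~Dc in w by PEM; this passes to w' and excludes Dc there. *)
  have [//|hn] := theory_pem (th w) (theory_base (th w) c).
  by case: (theory_pex (th w') h'); exact: ww'.
- by move=> P w s h i; exact: (@theory_def _ _ _ _ _ (th w) (Some P) s i h).
- by move=> P w s h i; exact: (@theory_defN _ _ _ _ _ (th w) (Some P) s i h).
- by move=> P w w' ww' s; exact: ww'.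
- by move=> P w w' ww' s; exact: ww'.
- by move=> w a b; exact: theory_def2.
- by move=> w a b; exact: theory_defN2.
- by move=> w a; exact: theory_eq_refl.
- by move=> w a b; exact: theory_eq_sym.
- by move=> w a b c; exact: theory_eq_trans.
- move=> P w s s' h; exact: (@theory_congr _ _ _ _ _ (th w) true (Some P) s s' h).
- move=> P w s s' h; exact: (@theory_congr _ _ _ _ _ (th w) false (Some P) s s' h).
- move=> P w s s' a a' hs hs' hr.
  have {}hs : @extension L canonical_structure true P w s by [].
  have {}hs' : @extension L canonical_structure false P w s' by [].
  rewrite canonical_extension in hs; rewrite canonical_extension in hs'.
  have h := theory_replaced (th w) hs hs' hr.
  by split=> //; exact: theory_neq_sym.
- by move=> w w' a b ww'; exact: ww'.
- by move=> w w' a b ww'; exact: ww'.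
Qed.

End Canonical.
Arguments canonical_structure {Pr} ar {C} hC.

(** * Completeness *)

Section Completeness.
Variables (Pr : Type) (ar : Pr -> nat) (C : Type).
Variable hC : infinite_set [set: C].
Local Notation L := (@Language C Pr ar hC).
Local Notation L' := (code_language ar hC).
Local Notation canon := (canonical_structure ar hC).
Local Notation world' := (theories ar hC).
Implicit Types (A B D : formula L') (c d : const L') (w : world').

Lemma occurs_level A : exists k, forall c, occurs c A -> level c <= k.
Proof.
have [l hl] := occurs_finite A.
suff [k hk] : exists k, forall c, List.In c l -> level c <= k.
  by exists k => c /hl /hk.
elim: l {hl} => [|c l [k hk]]; first by exists 0.
exists (maxn (level c) k) => d [<-|/hk h]; first exact: leq_maxl.
exact: leq_trans h (leq_maxr _ _).
Qed.

(** The source of larger stages: when an implication, a universal or a negated existential is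
    missing from w, the counterexample lies at a theory above w. Its bound starts from the maximum
    of the levels of w, A and B. *)
Lemma theory_separate w A B : sentence A -> sentence B ->
  ~ provable (A |` sval w) B ->
  exists w', [/\ sval w `<=` sval w', sval w' A & ~ sval w' B].
Proof.
have thw := svalP w; move=> sA sB nB.
have [k hk] := theory_level thw.
have [kA hA] := occurs_level A; have [kB hB] := occurs_level B.
pose m := maxn k (maxn kA kB).
have mk : k <= m by exact: leq_maxl.
have mA : kA <= m by rewrite /m leq_max leq_maxl orbT.
have mB : kB <= m by rewrite /m leq_max leq_maxr orbT.
have [|||X [thX TX nX]] := @theory_extension _ _ _ _ m (A |` sval w) B _ sB _ _ nB.
- move=> D [->//|]; exact: (saturated_sentence (theory_saturated thw)).
- move=> c [D [->|hD] hc]; first exact: leq_trans (hA _ hc) mA.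
  by apply: leq_trans mk; apply: hk; exists D.
- by move=> c /hB h; exact: leq_trans h mB.
exists (exist _ X thX); split => /= [D ?||hXB].
- by apply: TX; right.
- by apply: TX; left.
- by apply: nX; exact: theory_provable.
Qed.

Lemma theory_fresh w : exists c, ~ lang (sval w) c.
Proof.
have [k hk] := theory_level (svalP w).
by exists (CNode k.+1 [::]) => /hk /=; rewrite ltnNge leqnSn.
Qed.

Definition canonical_val (t : term L') (w : world') : option (const L') :=
  if t is Cst c then if `[< sval w (Def (Cst c)) >] then Some c else None
  else None.

Definition satC p A w :=
  @sat L' world' (@le L canon) (const L') (@dom L canon) (@extension L canon)
    p A canonical_val w.

Lemma satC_subst p c x B w : sval w (Def (Cst c)) ->
  @sat L' world' (@le L canon) (const L') (@dom L canon) (@extension L canon)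
    p B (upd canonical_val (Var x) (fun=> Some c)) w <-> satC p (subst c x B) w.
Proof.
move=> hc; rewrite /satC sat_subst; apply: sat_ext => /= [u|u v ?|].
- by [].
- by move=> uv vw B' /uv /vw.
move=> t w' ww' _; rewrite /upd; case: asboolP => // _ /=.
by case: asboolP => // -[]; exact: ww'.
Qed.

Lemma satC_atom p (P : predE L') (ts : (arityE P).-tuple (term L')) w :
  sentence (Atom ts) -> satC p (Atom ts) w <-> sval w (signed p (Atom ts)).
Proof.
move=> sT; have [f hf] : exists f : _ -> const L', forall i, tnth ts i = Cst (f i).
  suff h : forall i, exists c : const L', tnth ts i = Cst c.
    by have [f hf] := choice h; exists f.
  move=> i.
  case E: (tnth ts i) => [x|c]; last by exists c.
  by case/negP: (sT x); apply/has_tnthP; exists i; rewrite E /=.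
have -> : ts = map_tuple (@Cst L') (mktuple f).
  by apply: eq_from_tnth => i; rewrite hf tnth_map tnth_mktuple.
set cs := mktuple f; split.
  move=> [s hs]; rewrite canonical_extension.
  suff -> : s = cs by [].
  apply: eq_from_tnth => i; move: (hs i); rewrite tnth_map /=.
  by case: asboolP => // _ [].
move=> h; exists cs; last by rewrite canonical_extension.
move=> i; rewrite tnth_map /=; case: asboolP => // -[].
(* The arguments denote because DI puts their definedness into the theory, whether the atom is
   asserted or negated. *)
case: p h => h; [exact: (theory_def (svalP w) i h)|exact: (theory_defN (svalP w) i h)].
Qed.

Lemma sentence_binary B D : sentence (And B D) -> sentence B /\ sentence D.
Proof. by move=> h; split=> x; have /norP[] := h x. Qed.

Lemma sentence_instance c x B : sentence (All x B) -> sentence (subst c x B).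
Proof.
move=> h; apply: subst_sentence => y yx; have := h y.
by rewrite /= eq_sym yx.
Qed.

(** * Theories obey the clauses of the valuation *)

Section Closure.
Variable w : world'.
Let thw := svalP w.
Let X := sval w.

Let rule1 A B : (forall H, deduction H A -> deduction H B) ->
  (forall c, occurs c B -> lang X c) -> X A -> X B.
Proof. exact: theory_rule1. Qed.

Let rule2 A B D :
  (forall H1 H2, deduction H1 A -> deduction H2 B -> deduction (H1 `|` H2) D) ->
  (forall c, occurs c D -> lang X c) -> X A -> X B -> X D.
Proof. exact: theory_rule2. Qed.

Let closed B : provable X B -> (forall c, occurs c B -> lang X c) -> X B.
Proof. exact: (saturated_closed (theory_saturated thw)). Qed.

Let prX (G : set (formula L')) B : sentence B -> G B -> provable G B.
Proof. exact: provable_hyp. Qed.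

Lemma theory_And B D : (forall c, occurs c (And B D) -> lang X c) ->
  X (And B D) <-> X B /\ X D.
Proof.
move=> h; split=> [hBD|[hB hD]].
  split; apply: rule1 hBD => [H|c hc]; [exact: d_andE1|by apply: h; left
    |exact: d_andE2|by apply: h; right].
by apply: rule2 hB hD => // H1 H2; exact: d_andI.
Qed.

Lemma theory_Or B D : sentence B -> sentence D ->
  (forall c, occurs c (Or B D) -> lang X c) -> X (Or B D) <-> X B \/ X D.
Proof.
move=> sB sD h; split; first exact: (saturated_prime (theory_saturated thw)).
by case; apply: rule1 => // H; [exact: d_orI1|exact: d_orI2].
Qed.

Lemma theory_NotNot B : (forall c, occurs c B -> lang X c) ->
  X (Not (Not B)) <-> X B.
Proof.
by move=> h; split; apply: rule1 => // H; [exact: d_dnE|exact: d_dnI].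
Qed.

Lemma theory_NotOr B D : (forall c, occurs c (Or B D) -> lang X c) ->
  X (Not (Or B D)) <-> X (Not B) /\ X (Not D).
Proof.
move=> h; split=> [hBD|[hB hD]].
  split; apply: rule1 hBD => [H|c hc]; [exact: d_norE1|by apply: h; left
    |exact: d_norE2|by apply: h; right].
by apply: rule2 hB hD => // H1 H2; exact: d_norI.
Qed.

(** The elimination rule yields the disjunction of the negations, and primality splits it. *)
Lemma theory_NotAnd B D : sentence B -> sentence D ->
  (forall c, occurs c (And B D) -> lang X c) ->
  X (Not (And B D)) <-> X (Not B) \/ X (Not D).
Proof.
move=> sB sD h; split; last first.
  by case; apply: rule1 => // H; [exact: d_nandI1|exact: d_nandI2].
move=> hBD; apply/theory_Or => //; apply: closed => //.
apply: (@provable_nandE _ _ B D); first exact: theory_provable hBD.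
  by apply: (@provable1 _ _ (Not B)) => [H|]; [exact: d_orI1|apply: prX => //; left].
by apply: (@provable1 _ _ (Not D)) => [H|]; [exact: d_orI2|apply: prX => //; left].
Qed.

Lemma theory_NotImp B D : (forall c, occurs c (Imp B D) -> lang X c) ->
  X (Not (Imp B D)) <-> X B /\ X (Not D).
Proof.
move=> h; split=> [hBD|[hB hD]].
  split; apply: rule1 hBD => [H|c hc]; [exact: d_nimpE1|by apply: h; left
    |exact: d_nimpE2|by apply: h; right].
by apply: rule2 hB hD => // H1 H2; exact: d_nimpI.
Qed.

Lemma theory_Imp B D : sentence B -> sentence D ->
  (forall c, occurs c (Imp B D) -> lang X c) ->
  X (Imp B D) <-> forall w', X `<=` sval w' -> sval w' B -> sval w' D.
Proof.
move=> sB sD h; split=> [hBD w' ww' hB|H].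
  have hD c : occurs c D -> lang (sval w') c.
    by move=> hc; exists (Imp B D); [exact: ww'|right].
  by apply: (theory_rule2 (svalP w') _ hD (ww' _ hBD) hB) => H1 H2; exact: d_impE.
apply: closed => //; apply: contrapT => nBD.
have [|w' [ww' hB]] := @theory_separate w B D sB sD; last by apply; exact: H.
by move=> hD; apply: nBD; exact: provable_impI.
Qed.

Lemma occurs_instance c d x B : (forall e, occurs e B -> lang X e) ->
  lang X c -> occurs d (subst c x B) -> lang X d.
Proof. by move=> h hc /occurs_subst[->|/h]. Qed.

Lemma theory_Ex x B : (forall c, occurs c B -> lang X c) ->
  X (Ex x B) <-> exists2 c, X (Def (Cst c)) & X (subst c x B).
Proof.
move=> h; split.
  by move=> /(saturated_witness (theory_saturated thw))[c [h1 h2]]; exists c.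
by move=> [c h1 h2]; apply: rule2 h2 h1 => // H1 H2; exact: d_exI.
Qed.

(** Elimination with a fresh eigenvariable derives the existential of Not B, whose witness is the
    required one. *)
Lemma theory_NotAll x B : sentence (All x B) ->
  (forall c, occurs c B -> lang X c) ->
  X (Not (All x B)) <-> exists2 c, X (Def (Cst c)) & X (Not (subst c x B)).
Proof.
move=> sB h; split; last first.
  by move=> [c h1 h2]; apply: rule2 h2 h1 => // H1 H2; exact: d_nallI.
move=> hB; suff: X (Ex x (Not B)) by move=> /theory_Ex; apply.
apply: closed => //; have [c nc] := theory_fresh w.
have ncB : ~ occurs c B by move=> /h.
apply: (@provable_nallE _ _ c x B) => //.
- by move=> D hD hc; apply: nc; exists D.
- exact: theory_provable.
- apply: (@provable2 _ _ (Not (subst c x B)) (Def (Cst c))).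
  + by move=> H1 H2; exact: (@d_exI _ H1 H2 c x (Not B)).
  + by apply: prX; [exact: (sentence_instance c sB)|left].
  + by apply: prX => //; right; left.
Qed.

(** For the converse take c outside the language of w. If Dc led to B(c), the introduction rule
    would give the universal; otherwise some larger theory contains Dc without B(c). [theory_NotEx]
    is dual. *)
Lemma theory_All x B : sentence (All x B) ->
  (forall c, occurs c B -> lang X c) ->
  X (All x B) <-> forall w', X `<=` sval w' -> forall c, sval w' (Def (Cst c)) ->
    sval w' (subst c x B).
Proof.
move=> sB h; split=> [hB w' ww' c hc|H].
  apply: (theory_rule2 (svalP w') _ _ (ww' _ hB) hc) => [H1 H2|d].
    exact: d_allE.
  by move=> /occurs_subst[->|hd]; [exact: lang_Def|exists (All x B); [exact: ww'|]].
apply: closed => //; apply: contrapT => nB; have [c nc] := theory_fresh w.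
have [//||w' [ww' hc]] := @theory_separate w (Def (Cst c)) (subst c x B) _
  (sentence_instance c sB); last by apply; exact: H.
move=> hB; apply: nB; apply: provable_allI hB; first by move=> /h.
by move=> D hD hc; apply: nc; exists D.
Qed.

Lemma theory_NotEx x B : sentence (Ex x B) ->
  (forall c, occurs c B -> lang X c) ->
  X (Not (Ex x B)) <-> forall w', X `<=` sval w' ->
    forall c, sval w' (Def (Cst c)) -> sval w' (Not (subst c x B)).
Proof.
move=> sB h; split=> [hB w' ww' c hc|H].
  apply: (theory_rule2 (svalP w') _ _ (ww' _ hB) hc) => [H1 H2|d].
    exact: d_nexE.
  by move=> /occurs_subst[->|hd]; [exact: lang_Def|exists (Not (Ex x B)); [exact: ww'|]].
apply: closed => //; apply: contrapT => nB; have [c nc] := theory_fresh w.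
have [//||w' [ww' hc]] := @theory_separate w (Def (Cst c)) (Not (subst c x B)) _
  (sentence_instance c sB); last by apply; exact: H.
move=> hB; apply: nB; apply: provable_nexI hB; first by move=> /h.
by move=> D hD hc; apply: nc; exists D.
Qed.

Lemma theory_Def c : lang X c ->
  (X (Def (Cst c)) <-> exists a, canonical_val (Cst c) w = Some a) /\
  (X (Not (Def (Cst c))) <-> canonical_val (Cst c) w = None).
Proof.
move=> hc; rewrite /canonical_val; case: asboolP => h.
  by split; split=> //; [exists c|move=> /(theory_pex thw h)].
split; split=> //; first by case.
by have [//|] := theory_pem thw hc.
Qed.

End Closure.

(** The restriction to constants of w is essential: a constant foreign to w is undefined there, so
    Dc is falsified, while w contains no formula mentioning c. *)
Lemma truth A w : sentence A -> (forall c, occurs c A -> lang (sval w) c) ->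
  (satC true A w <-> sval w A) /\ (satC false A w <-> sval w (Not A)).
Proof.
have [n] := ubnP (fsize A); elim: n A w => // n IH A w; rewrite ltnS.
have IH2 B D v : fsize B + fsize D < n -> sentence (And B D) ->
    (forall c, occurs c (And B D) -> lang (sval v) c) ->
    [/\ sentence B, sentence D,
      (satC true B v <-> sval v B) /\ (satC false B v <-> sval v (Not B)) &
      (satC true D v <-> sval v D) /\ (satC false D v <-> sval v (Not D))].
  move=> hn /sentence_binary[sB sD] h; split=> //; apply: IH => //.
  - exact: leq_ltn_trans (leq_addr _ _) hn.
  - by move=> c hc; apply: h; left.
  - exact: leq_ltn_trans (leq_addl _ _) hn.
  - by move=> c hc; apply: h; right.
have IHq x B v c : fsize B < n -> sentence (All x B) ->
    (forall c, occurs c B -> lang (sval v) c) -> sval v (Def (Cst c)) ->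
    (satC true (subst c x B) v <-> sval v (subst c x B)) /\
    (satC false (subst c x B) v <-> sval v (Not (subst c x B))).
  move=> hn sB h hc; apply: IH; rewrite ?fsize_subst //.
    exact: sentence_instance.
  move=> d; apply: occurs_instance => //; exact: lang_Def.
have up B (v : world') : (forall c, occurs c B -> lang (sval w) c) ->
    sval w `<=` sval v -> forall c, occurs c B -> lang (sval v) c.
  by move=> h wv c /h[D hD hc]; exists D => //; exact: wv.
case: A => [P ts|t|B|B D|B D|B D|x B|x B] hn sA hA.
- by split; exact: satC_atom.
- case: t sA hA {hn} => [x /(_ x)|c _ hA]; first by rewrite /= eqxx.
  have [h1 h2] := @theory_Def w c (hA c erefl).
  by split; [rewrite h1|rewrite h2].
- have [h1 h2] := IH B w hn sA hA.
  by split; [exact: h2|rewrite theory_NotNot].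
- have [sB sD [B1 B2] [D1 D2]] := IH2 B D w hn sA hA.
  split; [rewrite theory_And //|rewrite theory_NotAnd //].
    by rewrite -B1 -D1.
  by rewrite -B2 -D2.
- have [sB sD [B1 B2] [D1 D2]] := IH2 B D w hn sA hA.
  split; [rewrite theory_Or //|rewrite theory_NotOr //].
    by rewrite -B1 -D1.
  by rewrite -B2 -D2.
- have [sB sD [B1 B2] [D1 D2]] := IH2 B D w hn sA hA.
  split; [rewrite theory_Imp //|rewrite theory_NotImp //]; last first.
    by rewrite -B1 -D2.
  split=> H v wv;
    have [_ _ [B1' _] [D1' _]] := IH2 B D v hn sA (up (And B D) v hA wv).
    by move=> /B1' /(H v wv) /D1'.
  by move=> /B1' /(H v wv) /D1'.
- split; [rewrite theory_All //|rewrite theory_NotAll //].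
    split=> H v wv c hc; have [I1 _] := IHq x B v c hn sA (up B v hA wv) hc.
      by apply/I1/satC_subst => //; exact: H.
    by apply/satC_subst => //; apply/I1; exact: H.
  split=> -[c hc H]; have [_ I2] := IHq x B w c hn sA hA hc; exists c => //.
    by apply/I2/satC_subst.
  by apply/satC_subst => //; apply/I2.
- split; [rewrite theory_Ex //|rewrite theory_NotEx //]; last first.
    split=> H v wv c hc; have [_ I2] := IHq x B v c hn sA (up B v hA wv) hc.
      by apply/I2/satC_subst => //; exact: H.
    by apply/satC_subst => //; apply/I2; exact: H.
  split=> -[c hc H]; have [I1 _] := IHq x B w c hn sA hA hc; exists c => //.
    by apply/I1/satC_subst.
  by apply/satC_subst => //; apply/I1.
Qed.

Lemma base_occurs (B : formula L) c :
  occurs c (base_lang B) -> exists e : C, c = CBase Pr e.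
Proof.
by move=> h; have [e _ ->] := @occurs_fmap _ _ _ _ _ _ (@CBase Pr C) B c h; exists e.
Qed.

Lemma canonical_forces (w : world') (B : formula L) : sentence B ->
  (@forces L canon w B <-> sval w (base_lang B)).
Proof.
move=> sB; have mK := canonical_is_model (inhabits w).
rewrite (@forces_satL L (Model mK) w B).
have h c : occurs c (base_lang B) -> lang (sval w) c.
  by move=> /base_occurs[e ->]; exact: theory_base (svalP w) _.
have [<- _] := @truth (base_lang B) w ((sentence_fmap _ _ _).2 sB) h.
rewrite /satC /base_lang sat_fmap /satL.
suff -> : @term_val L (Model mK) = fun t => canonical_val (tmap (@CBase Pr C) t) by [].
by apply/funext => -[].
Qed.

Lemma completeness (G : set (formula L)) (A : formula L) :
  (forall B : formula L, G B -> sentence B) -> sentence A ->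
  entails G A -> provable G A.
Proof.
move=> sG sA GA; apply: contrapT => nA.
have base_level (B : formula L) k c : occurs c (base_lang B) -> level c <= k.
  by move=> /base_occurs[e ->].
(* Copies of original constants have level 0, so that bound suits the given sequent. *)
have [|||||X [thX GX nX]] := @theory_extension _ _ _ hC 0
  (base_lang @` G) (base_lang A).
- by move=> _ [B /sG sB <-]; exact/sentence_fmap.
- exact/sentence_fmap.
- by move=> c [_ [B _ <-]]; exact: base_level.
- exact: base_level.
- move=> [H HG dA]; apply: nA.
  have [c0 _] := @fresh_const L [::].
  (* A retraction of [CBase] that sends all other trees to an arbitrary constant; it carries a
     deduction in the extended language back to the original sequent. *)
  pose g (e : code Pr C) : C := if e is CBase c then c else c0.
  have gK : cancel (@CBase Pr C) g by [].
  rewrite -(@fmap_cancel _ _ _ _ hC (code_infinite hC) _ _ A gK).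
  apply: (provable_fmap dA) => B /HG[D hD <-].
  by rewrite /base_lang fmap_cancel.
pose w : world' := exist _ X thX.
have mK := canonical_is_model (inhabits w).
apply: nX; apply: theory_provable => //.
apply/(canonical_forces w sA); apply: (GA (Model mK)) => B hB.
apply/(canonical_forces w (sG _ hB)); apply: GX; exists B => //.
Qed.

End Completeness.

Theorem theorem27 (L : language) (G : set (formula L)) (A : formula L)
    (hG : forall B, G B -> sentence B) (hA : sentence A) :
  provable G A <-> entails G A.
Proof.
split; first exact: provable_entails.
by case: L G A hG hA => C Pr ar hC G A; exact: completeness.
Qed.
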